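(* Let $G$ be a Brink-Howlett groupoid of $(W,S)$, and let $(G,\Lambda)$ be the signed groupoid-set with $\Lambda(J)=\Phi$ (with positive elements $\Phi^{+}$ and sign action $\alpha\mapsto\pm\alpha$) for every object $J$ of $G$, and with $\Lambda(K,w,J)\colon \Phi\to\Phi$ given by $\alpha\mapsto w\alpha$ for every morphism $(K,w,J)$ of $G$. Let $(G,\Lambda^{\mathrm{rec}})$ be its real compression. Then: (a) $(G,\Lambda)$ is a preprincipal, rootoidal signed groupoid-set with the set of Brink-Howlett generators of $G$ as its set of atomic morphisms. (b) $(G,\Lambda^{\mathrm{rec}})$ is a principal, rootoidal signed groupoid-set with the set of Brink-Howlett generators of $G$ as its set of simple morphisms.
   Context: **Based root systems.** For a subset $X$ of a real vector space, $\operatorname{cone}(X)$ is the set of finite linear combinations of elements of $X$ with non-negative coefficients (including $0$). $(V,B)$ is a real vector space with a symmetric bilinear form; for $B(\alpha,\alpha)\neq 0$, $s_\alpha(v)=v-\frac{2B(v,\alpha)}{B(\alpha,\alpha)}\alpha$. $(\Phi,\Pi)$ is a based root system in $(V,B)$ with associated Coxeter system $(W,S)$: $\Pi\subseteq V$; $\operatorname{cone}(\Pi)\cap\operatorname{cone}(-\Pi)=\{0\}$; for all $\alpha\in\Pi$, $\alpha\notin\operatorname{cone}(\Pi\setminus\{\alpha\})$ and $B(\alpha,\alpha)=1$; $S=\{s_\alpha\mid\alpha\in\Pi\}$, $W=\langle S\rangle$; $\Phi=\{w\alpha\mid w\in W,\alpha\in\Pi\}$ satisfies $\Phi=\Phi^+\cup\Phi^-$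 where $\Phi^{\pm}=\Phi\cap\operatorname{cone}(\pm\Pi)$. The rank $|S|$ may be infinite. For $J\subseteq\Pi$, $W_J=\langle s_\alpha\mid\alpha\in J\rangle$; if $W_J$ is finite, $w_J$ denotes its longest element. The Coxeter graph is regarded as having vertex set $\Pi$, distinct $\alpha,\beta$ being joined iff $s_\alpha s_\beta$ has order at least $3$ (possibly $\infty$). A component of $K\subseteq\Pi$ is the vertex set of a connected component of the full subgraph on $K$; it is of finite type if the subgroup it generates is finite. **Brink-Howlett groupoids.** The full Brink-Howlett groupoid of $(W,S)$ has as objects the subsets of $\Pi$; a morphism $J\to K$ is a triple $(K,w,J)$ with $w\in W$, $w(J)=K$; composition is $(L,v,K)(K,w,J)=(L,vw,J)$. A Brink-Howlett groupoid of $(W,S)$ is a union of connected components of it. A Brink-Howlett generator of $G$ is a morphism $(J',\nu(\alpha,J),J)$ of $G$ where $J$ is an object of $G$, $\alpha\in\Pi\setminus J$ is such that the component $L$ of $J\cup\{\alpha\}$ containing $\alpha$ is of finite type, $\nu(\alpha,J):=w_Lw_{L\cap J}$, and $J'=\nu(\alpha,J)J\subseteq J\cup\{\alpha\}$. **Signed groupoid-sets.** A definitely signed set is a set $X$ with a free action of $\{\pm1\}$ and a chosen set $X^+$ of orbit representatives (positive elements); $X^-=-X^+$. Morphisms are $\{\pm1\}$-equivariant maps (not necessarily preserving positivity). A signed groupoid-set $(G,X)$ is a groupoid $G$ with a functor $X$ from $G$ to definitely signed sets; write $gx=X(g)(x)$. For an object $a$, ${}_aG$ is the set of morphisms with codomain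 $a$. For $g\colon b\to a$, $X_g:=X(a)^+\cap g(X(b)^-)$. The weak preorder at $a$ on ${}_aG$ is $g\le_a h\iff X_g\subseteq X_h$. $(G,X)$ is faithful if for every object $a$ and $g,g'\in{}_aG$, $X_g=X_{g'}$ implies $g=g'$ (so each $\le_a$ is a partial order). $(G,X)$ is rootoidal if it is faithful and for each object $a$: (i) every non-empty subset of $({}_aG,\le_a)$ has a meet; (ii) if $P\subseteq{}_aG$ and $q\in{}_aG$ satisfy $X_p\cap X_q=\emptyset$ for all $p\in P$ and the join $p'=\bigvee P$ exists in $({}_aG,\le_a)$, then $X_{p'}\cap X_q=\emptyset$. For faithful $(G,X)$: $g\in{}_aG$ is simple if $|X_g|=1$, and atomic if it is an atom of $({}_aG,\le_a)$ (whose minimum is the identity $1_a$). For a generating set $C$ of $G$, $\ell_C(g)$ is the minimal number of factors in an expression of $g$ as a product of elements of $C$ and their inverses ($0$ for identities). $(G,X)$ is principal if it is (faithful and) generated by its set $R$ of simple morphisms and $\ell_R(g)=|X_g|$ for every morphism $g$. $(G,X)$ is preprincipal if it is (faithful and) generated by its set $A$ of atomic morphisms and for every object $a$, $g\in{}_aG$ and $s\in A\cap{}_aG$, either $X_s\subseteq X_g$ or $X_s\cap X_g=\emptyset$. A root $x\in X(a)$ is real if $g^{-1}x$ and $x$ have different signs for some $g\in{}_aG$. Two elements $x,y\in X(a)$ are parallel if $g^{-1}x$ and $g^{-1}y$ have the same sign for all $g\in{}_aG$. The real compression $(G,X^{\mathrm{rec}})$ has as $X^{\mathrm{rec}}(a)$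 the set of parallelism classes of real roots in $X(a)$, with $g[x]=[gx]$, $-[x]=[-x]$, and $[x]$ positive iff $x$ is positive. *)

(* Defs.v *)
From HB Require Import structures.
From Stdlib Require Import Relation_Operators.
From mathcomp Require Import all_boot all_order all_algebra.
From mathcomp Require Import all_classical all_reals.

Set Implicit Arguments.
Unset Strict Implicit.
Unset Printing Implicit Defensive.

Import Order.TTheory GRing.Theory Num.Theory.
Local Open Scope classical_set_scope.
Local Open Scope ring_scope.

(* [mcomp f g] is [f] after [g], as in the product notation [fg]. *)
Record groupoid := Groupoid {
  ob :> Type;
  mor : ob -> ob -> Type;
  idm : forall a, mor a a;
  mcomp : forall a b c, mor b c -> mor a b -> mor a c;
  minv : forall a b, mor a b -> mor b a;
  mcompA : forall a b c d (h : mor c d) (g : mor b c) (f : mor a b),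
    mcomp h (mcomp g f) = mcomp (mcomp h g) f;
  mcomp1m : forall a b (f : mor a b), mcomp (idm b) f = f;
  mcompm1 : forall a b (f : mor a b), mcomp f (idm a) = f;
  mcompVm : forall a b (f : mor a b), mcomp (minv f) f = idm a;
  mcompmV : forall a b (f : mor a b), mcomp f (minv f) = idm b }.
Arguments idm {g0} a : rename.

Section GroupoidTheory.
Variable G : groupoid.

Lemma mcomp_eq1_minv (a b : G) (f : mor a b) (g : mor b a) :
  mcomp g f = idm a -> g = minv f.
Proof. by move=> e; rewrite -[LHS]mcompm1 -(mcompmV f) mcompA e mcomp1m. Qed.

Lemma minvK (a b : G) (f : mor a b) : minv (minv f) = f.
Proof. by rewrite -(mcomp_eq1_minv (mcompmV f)). Qed.

Lemma minv_comp (a b c : G) (g : mor b c) (f : mor a b) :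
  minv (mcomp g f) = mcomp (minv f) (minv g).
Proof.
apply/esym/mcomp_eq1_minv.
by rewrite -mcompA [mcomp (minv g) _]mcompA mcompVm mcomp1m mcompVm.
Qed.

Definition component_of (a : G) : set G := [set b | inhabited (mor a b)].

Definition union_of_components (O : set G) : Prop :=
  exists A : set G, O = \bigcup_(a in A) component_of a.

Definition morphisms := forall a b : G, mor a b -> Prop.

(* [word C n g]: the morphism [g] is a product of [n] factors, each of which
   is an element of [C] or the inverse of one. *)
Inductive word (C : morphisms) : forall a b : G, nat -> mor a b -> Prop :=
| word_idm a : word C 0%N (idm a)
| word_comp a b c n (s : mor b c) (g : mor a b) :
    C b c s -> word C n g -> word C n.+1 (mcomp s g)
| word_compV a b c n (s : mor c b) (g : mor a b) :
    C c b s -> word C n g -> word C n.+1 (mcomp (minv s) g).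

Definition generates (C : morphisms) : Prop :=
  forall (a b : G) (g : mor a b), exists n, word C n g.

Definition length_is (C : morphisms) (a b : G) (g : mor a b) (n : nat) : Prop :=
  word C n g /\ forall m, word C m g -> (n <= m)%N.

Definition into (a : G) := {b : G & mor b a}.
Definition to_into (a b : G) (g : mor b a) : into a := existT _ b g.

End GroupoidTheory.

Definition full_subgroupoid (G : groupoid) (O : set G) : groupoid :=
  @Groupoid {a : G | O a} (fun a b => mor (sval a) (sval b))
    (fun a => idm (sval a)) (fun a b c f g => mcomp f g) (fun a b f => minv f)
    (fun _ _ _ _ h g f => mcompA h g f) (fun _ _ f => mcomp1m f)
    (fun _ _ f => mcompm1 f) (fun _ _ f => mcompVm f) (fun _ _ f => mcompmV f).

(* The last field says that exactly one of [x], [- x] is positive. *)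
Record signed_set := SignedSet {
  sset :> Type;
  sopp : sset -> sset;
  spos : set sset;
  soppK : involutive sopp;
  sopp_free : forall x, sopp x <> x;
  spos_opp : forall x, spos (sopp x) <-> ~ spos x }.

Definition sneg (X : signed_set) : set X := @sopp X @` @spos X.

Definition same_sign (X Y : signed_set) (x : X) (y : Y) : Prop :=
  spos x <-> spos y.

Record signed_gset (G : groupoid) := SignedGset {
  fib :> G -> signed_set;
  act : forall a b : G, mor a b -> fib a -> fib b;
  act_opp : forall a b (g : mor a b) x, act g (sopp x) = sopp (act g x);
  act_idm : forall a x, act (idm a) x = x;
  act_comp : forall a b c (g : mor b c) (f : mor a b) x,
    act (mcomp g f) x = act g (act f x) }.

Section SignedGsetTheory.
Variables (G : groupoid) (X : signed_gset G).

Lemma actK (a b : G) (g : mor a b) : cancel (@act G X a b g) (act (minv g)).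
Proof. by move=> x; rewrite -act_comp mcompVm act_idm. Qed.

Lemma actVK (a b : G) (g : mor a b) : cancel (@act G X b a (minv g)) (act g).
Proof. by move=> x; rewrite -act_comp mcompmV act_idm. Qed.

Definition inversions (b a : G) (g : mor b a) : set (X a) :=
  @spos (X a) `&` act g @` @sneg (X b).

Definition into_inversions (a : G) (g : into a) : set (X a) :=
  inversions (projT2 g).

Definition wle (a : G) (g h : into a) : Prop :=
  into_inversions g `<=` into_inversions h.

Definition faithful : Prop :=
  forall (a : G) (g h : into a), into_inversions g = into_inversions h -> g = h.

Definition is_meet (a : G) (P : set (into a)) (m : into a) : Prop :=
  (forall p, P p -> wle m p) /\
  (forall l, (forall p, P p -> wle l p) -> wle l m).

Definition is_join (a : G) (P : set (into a)) (j : into a) : Prop :=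
  (forall p, P p -> wle p j) /\
  (forall u, (forall p, P p -> wle p u) -> wle j u).

Definition rootoidal : Prop :=
  faithful /\
  forall a : G,
    (forall P : set (into a), P !=set0 -> exists m, is_meet P m) /\
    (forall (P : set (into a)) (q p' : into a),
       (forall p, P p -> into_inversions p `&` into_inversions q = set0) ->
       is_join P p' -> into_inversions p' `&` into_inversions q = set0).

Definition simple : morphisms G :=
  fun b a g => (inversions g #= `I_1)%card.

Definition atomic : morphisms G :=
  fun b a g => to_into g <> to_into (idm a) /\
    forall h : into a, wle h (to_into g) -> h = to_into (idm a) \/ h = to_into g.

(* The first conjunct of the last clause says that the length is finite and
   the second that the set of inversions has as many elements. *)
Definition principal : Prop :=
  [/\ faithful, generates simple &
      forall (b a : G) (g : mor b a),
        exists n, length_is simple g n /\ (inversions g #= `I_n)%card].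

Definition preprincipal : Prop :=
  [/\ faithful, generates atomic &
      forall (a b c : G) (g : mor b a) (s : mor c a), atomic s ->
        inversions s `<=` inversions g \/ inversions s `&` inversions g = set0].

Definition real_root (a : G) (x : X a) : Prop :=
  exists (b : G) (g : mor b a), ~ same_sign (act (minv g) x) x.

Definition parallel (a : G) (x y : X a) : Prop :=
  forall (b : G) (g : mor b a), same_sign (act (minv g) x) (act (minv g) y).

End SignedGsetTheory.
Arguments simple {G} X [a b] g : rename.
Arguments atomic {G} X [a b] g : rename.

Section RealCompression.
Variables (G : groupoid) (X : signed_gset G).

Definition pclass (a : G) (x : X a) : set (X a) :=
  [set y | real_root y /\ parallel x y].

Definition rec_fib (a : G) := {C : set (X a) | exists2 x, real_root x & C = pclass x}.

Lemma rec_fib_inj (a : G) (C D : rec_fib a) : sval C = sval D -> C = D.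
Proof. exact: eq_sig_hprop => ? ? ?; exact: Prop_irrelevance. Qed.

Lemma spos_oppE (S : signed_set) (x : S) : spos (sopp x) = ~ spos x.
Proof. exact/propext/spos_opp. Qed.

Lemma same_signN (S T : signed_set) (x : S) (y : T) :
  same_sign (sopp x) (sopp y) <-> same_sign x y.
Proof.
rewrite /same_sign !spos_oppE; split; last by move=> [? ?]; split; tauto.
by move=> [h1 h2]; split=> ?; apply: contrapT; tauto.
Qed.

Lemma parallel_refl (a : G) (x : X a) : parallel x x.
Proof. by []. Qed.

Lemma parallel_sym (a : G) (x y : X a) : parallel x y -> parallel y x.
Proof. by move=> h b g; have [] := h b g. Qed.

Lemma parallel_trans (a : G) (y x z : X a) :
  parallel x y -> parallel y z -> parallel x z.
Proof. by move=> h k b g; have [? ?] := h b g; have [? ?] := k b g; split; tauto. Qed.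

Lemma parallel_sign (a : G) (x y : X a) : parallel x y -> same_sign x y.
Proof.
by move=> /(_ a (idm a)); rewrite -(mcomp_eq1_minv (mcompm1 (idm a))) !act_idm.
Qed.

Lemma parallel_opp (a : G) (x y : X a) :
  parallel x y -> parallel (sopp x) (sopp y).
Proof. by move=> h b g; rewrite !act_opp; apply/same_signN/h. Qed.

Lemma parallel_act (a b : G) (g : mor a b) (x y : X a) :
  parallel x y -> parallel (act g x) (act g y).
Proof.
by move=> h c k; rewrite -!act_comp -{1 2}(minvK g) -minv_comp; apply: h.
Qed.

Lemma real_root_opp (a : G) (x : X a) : real_root x -> real_root (sopp x).
Proof.
by move=> [b [g h]]; exists b, g; rewrite act_opp => /same_signN.
Qed.

Lemma real_root_act (a b : G) (g : mor a b) (x : X a) :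
  real_root x -> real_root (act g x).
Proof.
move=> [c [h hx]].
have [s|s] := pselect (same_sign x (act g x)); last first.
  by exists a, g; rewrite actK.
exists c, (mcomp g h); rewrite minv_comp act_comp actK => k; apply: hx.
by move: s k => [? ?] [? ?]; split; tauto.
Qed.

Lemma pclassP (a : G) (x y : X a) :
  real_root y -> pclass x = pclass y <-> parallel x y.
Proof.
move=> ry; split=> [e|h].
  by have : pclass y y by []; rewrite -e => -[].
by apply/seteqP; split=> z [rz p]; split=> //;
  [apply: parallel_trans p; exact: parallel_sym | exact: parallel_trans h p].
Qed.

Lemma rec_class (a : G) (x : X a) : real_root x ->
  exists2 y, real_root y & pclass x = pclass y.
Proof. by exists x. Qed.

Definition to_rec (a : G) (x : X a) (rx : real_root x) : rec_fib a :=
  exist _ (pclass x) (rec_class rx).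

Definition rec_repr (a : G) (C : rec_fib a) : X a := s2val (cid2 (svalP C)).

Lemma rec_repr_real (a : G) (C : rec_fib a) : real_root (rec_repr C).
Proof. by rewrite /rec_repr; case: cid2. Qed.

Lemma rec_reprK (a : G) (C : rec_fib a) : to_rec (rec_repr_real C) = C.
Proof. by apply: rec_fib_inj; rewrite /= /rec_repr; case: cid2. Qed.

Lemma to_rec_eq (a : G) (x y : X a) (rx : real_root x) (ry : real_root y) :
  to_rec rx = to_rec ry <-> parallel x y.
Proof.
rewrite -(pclassP _ ry); split=> [e|e]; last exact: rec_fib_inj.
exact: (congr1 sval e).
Qed.

Lemma rec_repr_to_rec (a : G) (x : X a) (rx : real_root x) :
  parallel (rec_repr (to_rec rx)) x.
Proof. by apply/(to_rec_eq (rec_repr_real _) rx); rewrite rec_reprK. Qed.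

Lemma rec_ind (a : G) (P : rec_fib a -> Prop) :
  (forall (x : X a) (rx : real_root x), P (to_rec rx)) -> forall C, P C.
Proof. by move=> h C; rewrite -(rec_reprK C). Qed.

(* The operations are defined through chosen representatives; the lemmas
   [rec_opp_class], [rec_pos_class] and [rec_act_class] below give their values
   on the class of an arbitrary real root. *)
Definition rec_opp (a : G) (C : rec_fib a) : rec_fib a :=
  to_rec (real_root_opp (rec_repr_real C)).

Definition rec_pos (a : G) : set (rec_fib a) := [set C | spos (rec_repr C)].

Definition rec_act (a b : G) (g : mor a b) (C : rec_fib a) : rec_fib b :=
  to_rec (real_root_act g (rec_repr_real C)).

Lemma rec_opp_class (a : G) (x : X a) (rx : real_root x) :
  rec_opp (to_rec rx) = to_rec (real_root_opp rx).
Proof. exact/to_rec_eq/parallel_opp/rec_repr_to_rec. Qed.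

Lemma rec_pos_class (a : G) (x : X a) (rx : real_root x) :
  rec_pos (to_rec rx) <-> spos x.
Proof. exact/parallel_sign/rec_repr_to_rec. Qed.

Lemma rec_act_class (a b : G) (g : mor a b) (x : X a) (rx : real_root x) :
  rec_act g (to_rec rx) = to_rec (real_root_act g rx).
Proof. exact/to_rec_eq/parallel_act/rec_repr_to_rec. Qed.

Lemma rec_oppK (a : G) : involutive (@rec_opp a).
Proof.
elim/rec_ind => x rx; rewrite !rec_opp_class.
by apply/to_rec_eq; rewrite soppK; apply: parallel_refl.
Qed.

Lemma rec_pos_opp (a : G) (C : rec_fib a) : rec_pos (rec_opp C) <-> ~ rec_pos C.
Proof.
elim/rec_ind: C => x rx; rewrite rec_opp_class.
by rewrite !(propext (rec_pos_class _)) spos_oppE.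
Qed.

Lemma rec_opp_free (a : G) (C : rec_fib a) : rec_opp C <> C.
Proof. by move=> e; have := rec_pos_opp C; rewrite e; tauto. Qed.

Definition rec_set (a : G) : signed_set :=
  SignedSet (@rec_oppK a) (@rec_opp_free a) (@rec_pos_opp a).

Lemma rec_act_opp (a b : G) (g : mor a b) (C : rec_set a) :
  rec_act g (sopp C) = @sopp (rec_set b) (rec_act g C).
Proof.
elim/rec_ind: C => x rx; rewrite /= rec_opp_class !rec_act_class rec_opp_class.
by apply/to_rec_eq; rewrite act_opp; apply: parallel_refl.
Qed.

Lemma rec_act_idm (a : G) (C : rec_set a) : rec_act (idm a) C = C.
Proof.
elim/rec_ind: C => x rx; rewrite rec_act_class.
by apply/to_rec_eq; rewrite act_idm; apply: parallel_refl.
Qed.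

Lemma rec_act_comp (a b c : G) (g : mor b c) (f : mor a b) (C : rec_set a) :
  rec_act (mcomp g f) C = rec_act g (rec_act f C).
Proof.
elim/rec_ind: C => x rx; rewrite !rec_act_class.
by apply/to_rec_eq; rewrite act_comp; apply: parallel_refl.
Qed.

Definition real_compression : signed_gset G :=
  @SignedGset G rec_set rec_act rec_act_opp rec_act_idm rec_act_comp.

End RealCompression.

Section BasedRootSystems.
Variables (R : realType) (V : lmodType R).

Definition cone (A : set V) : set V :=
  [set v | exists (n : nat) (c : 'I_n -> R) (x : 'I_n -> V),
     [/\ forall i, 0 <= c i, forall i, A (x i) & v = \sum_i c i *: x i]].

Definition oppset (A : set V) : set V := [set - v | v in A].

Variable B : {symmetric V}.

Definition refl (a v : V) : V := v - (2 * B v a / B a a) *: a.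

(* The subgroup of the group of bijections of [V] generated by the reflections
   in the elements of [J]. *)
Inductive refl_group (J : set V) : (V -> V) -> Prop :=
| refl_group_id : refl_group J id
| refl_group_refl a : J a -> refl_group J (refl a)
| refl_group_comp f g :
    refl_group J f -> refl_group J g -> refl_group J (f \o g)
| refl_group_inv f g :
    refl_group J f -> cancel f g -> cancel g f -> refl_group J g.

Record based_root_system (Phi Pi : set V) : Prop := BasedRootSystem {
  brs_pointed : cone Pi `&` cone (oppset Pi) = [set 0];
  brs_extreme : forall a, Pi a -> ~ cone (Pi `\ a) a;
  brs_unit : forall a, Pi a -> B a a = 1;
  brs_roots : Phi = [set v | exists w a, [/\ refl_group Pi w, Pi a & v = w a]];
  brs_signs : Phi = (Phi `&` cone Pi) `|` (Phi `&` cone (oppset Pi)) }.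

Definition refl_word (s : seq V) : V -> V :=
  foldr (fun a w => refl a \o w) id s.

(* [n] is the length of [w] in the Coxeter system with generators the
   reflections in the elements of [J]. *)
Definition cox_length (J : set V) (w : V -> V) (n : nat) : Prop :=
  (exists s : seq V, [/\ forall a, a \in s -> J a, w = refl_word s & size s = n]) /\
  (forall s : seq V, (forall a, a \in s -> J a) -> w = refl_word s ->
     (n <= size s)%N).

Definition is_longest (J : set V) (w : V -> V) : Prop :=
  refl_group J w /\
  exists2 n, cox_length J w n &
    forall v m, refl_group J v -> cox_length J v m -> (m <= n)%N.

(* The longest element [w_J]; the value is junk if the group is infinite. *)
Definition longest (J : set V) : V -> V :=
  xget (id : V -> V) [set w | is_longest J w].

Definition finite_type (J : set V) : Prop := finite_set [set w | refl_group J w].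

(* The order of the product of the two reflections is at least 3 or infinite. *)
Definition cox_edge (a b : V) : Prop :=
  a <> b /\ forall n, (0 < n < 3)%N -> iter n (refl a \o refl b) <> id.

Definition cox_component (K : set V) (a : V) : set V :=
  [set b | clos_refl_trans V (fun x y => [/\ K x, K y & cox_edge x y]) a b].

Definition nu (a : V) (J : set V) : V -> V :=
  let L := cox_component (J `|` [set a]) a in longest L \o longest (L `&` J).


Variables Phi Pi : set V.
Hypothesis brs : based_root_system Phi Pi.

Lemma reflK a : Pi a -> involutive (refl a).
Proof.
move=> /(brs_unit brs) Baa v; rewrite /refl Baa !divr1.
rewrite [B (_ - _) _]linearBl /= linearZl_LR /= Baa mulr1.
have -> : B v a - 2 * B v a = - B v a by rewrite mulr_natl mulr2n opprD addNKr.
by rewrite mulrN scaleNr opprK subrK.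
Qed.

Lemma refl_opp a v : refl a (- v) = - refl a v.
Proof. by rewrite /refl linearNl mulrN mulNr scaleNr opprB opprK addrC. Qed.

Lemma refl_self a : Pi a -> refl a a = - a.
Proof.
move=> /(brs_unit brs) Baa; rewrite /refl Baa divr1 mulr1 scaler_nat mulr2n.
by rewrite opprD addNKr.
Qed.

Lemma refl_group_bij f : refl_group Pi f ->
  exists g, [/\ refl_group Pi g, cancel f g & cancel g f].
Proof.
elim=> {f} [|a Pa|f g _ [f' [Wf' ff' f'f]] _ [g' [Wg' gg' g'g]]|f g Wf _ fg gf].
- by exists id; split=> //; exact: refl_group_id.
- by exists (refl a); split; [exact: refl_group_refl|exact: reflK|exact: reflK].
- exists (g' \o f'); split; [exact: refl_group_comp|exact: can_comp|exact: can_comp].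
- by exists f.
Qed.

Lemma refl_group_opp f : refl_group Pi f -> forall v, f (- v) = - f v.
Proof.
elim=> {f} [//|a _ v|f g _ hf _ hg v|f g _ hf fg gf v].
- exact: refl_opp.
- by rewrite /= hg hf.
- by apply: (can_inj fg); rewrite gf hf gf.
Qed.

Lemma root_act f v : refl_group Pi f -> Phi v -> Phi (f v).
Proof.
move=> Wf; rewrite (brs_roots brs) => -[w [a [Ww Pa ->]]].
by exists (f \o w), a; split=> //; apply: refl_group_comp.
Qed.

Lemma root_opp v : Phi v -> Phi (- v).
Proof.
rewrite (brs_roots brs) => -[w [a [Ww Pa ->]]].
exists (w \o refl a), a; split=> //; last by rewrite /= refl_self// refl_group_opp.
by apply: refl_group_comp => //; apply: refl_group_refl.
Qed.

Lemma root_neq0 v : Phi v -> v <> 0.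
Proof.
rewrite (brs_roots brs) => -[w [a [Ww Pa ->]]] w0.
have a0 : a = - a.
  have [g [_ wg _]] := refl_group_bij Ww.
  by apply: (can_inj wg); rewrite refl_group_opp// w0 oppr0.
have Baa : B a a = 1 by exact: (brs_unit brs Pa).
have /eqP : B a a = - B a a by rewrite {1}a0 linearNl.
by rewrite Baa -addr_eq0 -mulr2n pnatr_eq0.
Qed.

Lemma cone_opp (A : set V) v : cone (oppset A) (- v) <-> cone A v.
Proof.
split=> -[n [c [x [c0 xA e]]]]; exists n, c, (fun i => - x i); split=> //.
- by move=> i; have [y Ay <-] := xA i; rewrite opprK.
- by rewrite -[LHS]opprK e -sumrN; apply: eq_bigr => i _; rewrite scalerN.
- by move=> i; exists (x i).
- by rewrite e -sumrN; apply: eq_bigr => i _; rewrite scalerN.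
Qed.

Definition root_type := {v : V | Phi v}.

Lemma root_inj (x y : root_type) : sval x = sval y -> x = y.
Proof. exact: eq_sig_hprop => ? ? ?; exact: Prop_irrelevance. Qed.

Definition ropp (x : root_type) : root_type := exist _ (- sval x) (root_opp (svalP x)).

Definition rpos : set root_type := [set x | cone Pi (sval x)].

Lemma roppK : involutive ropp.
Proof. by move=> x; apply: root_inj; rewrite /= opprK. Qed.

Lemma rpos_opp x : rpos (ropp x) <-> ~ rpos x.
Proof.
rewrite /rpos /=; split=> [h k|h].
  have : (cone Pi `&` cone (oppset Pi)) (- sval x).
    by split=> //; apply/cone_opp.
  rewrite (brs_pointed brs) /= => /(congr1 -%R); rewrite opprK oppr0.
  exact: root_neq0 (svalP x).
have := svalP x; rewrite {1}(brs_signs brs) => -[[_ //]|[_]].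
by rewrite -{1}[sval x]opprK => /cone_opp.
Qed.

Lemma ropp_free x : ropp x <> x.
Proof. by move=> e; have := rpos_opp x; rewrite e; tauto. Qed.

Definition root_set : signed_set := SignedSet roppK ropp_free rpos_opp.

Record bh_ob := BhOb { bh_set :> set V; bh_sub : bh_set `<=` Pi }.

Record bh_hom (J K : bh_ob) := BhHom {
  bh_fun :> V -> V;
  bh_group : refl_group Pi bh_fun;
  bh_image : bh_fun @` J = K }.

Lemma bh_hom_inj J K (f g : bh_hom J K) : bh_fun f = bh_fun g -> f = g.
Proof.
case: f g => [f f1 f2] [g g1 g2] /= e; case: _ / e in g1 g2 *.
by congr BhHom; apply: Prop_irrelevance.
Qed.

Definition bh_id J : bh_hom J J := BhHom (refl_group_id Pi) (image_id J).

Lemma bh_comp_image J K L (g : bh_hom K L) (f : bh_hom J K) : (g \o f) @` J = L.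
Proof. by rewrite -image_comp !bh_image. Qed.

Definition bh_comp J K L (g : bh_hom K L) (f : bh_hom J K) : bh_hom J L :=
  BhHom (refl_group_comp (bh_group g) (bh_group f)) (bh_comp_image g f).

Definition bh_invfun J K (f : bh_hom J K) : V -> V :=
  sval (cid (refl_group_bij (bh_group f))).

Lemma bh_funK J K (f : bh_hom J K) : cancel f (bh_invfun f).
Proof. by rewrite /bh_invfun; case: cid => g []. Qed.

Lemma bh_invfunK J K (f : bh_hom J K) : cancel (bh_invfun f) f.
Proof. by rewrite /bh_invfun; case: cid => g []. Qed.

Lemma bh_inv_group J K (f : bh_hom J K) : refl_group Pi (bh_invfun f).
Proof. by rewrite /bh_invfun; case: cid => g []. Qed.

Lemma bh_inv_image J K (f : bh_hom J K) : bh_invfun f @` K = J.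
Proof.
rewrite -(bh_image f) image_comp; apply/seteqP.
split=> [_ [x Jx <-]|x Jx]; first by rewrite /= bh_funK.
by exists x => //=; rewrite bh_funK.
Qed.

Definition bh_inv J K (f : bh_hom J K) : bh_hom K J :=
  BhHom (bh_inv_group f) (bh_inv_image f).

Lemma bh_compA J K L M (h : bh_hom L M) (g : bh_hom K L) (f : bh_hom J K) :
  bh_comp h (bh_comp g f) = bh_comp (bh_comp h g) f.
Proof. exact: bh_hom_inj. Qed.

Lemma bh_comp1m J K (f : bh_hom J K) : bh_comp (bh_id K) f = f.
Proof. exact: bh_hom_inj. Qed.

Lemma bh_compm1 J K (f : bh_hom J K) : bh_comp f (bh_id J) = f.
Proof. exact: bh_hom_inj. Qed.

Lemma bh_compVm J K (f : bh_hom J K) : bh_comp (bh_inv f) f = bh_id J.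
Proof. by apply: bh_hom_inj; apply/funext => x /=; rewrite bh_funK. Qed.

Lemma bh_compmV J K (f : bh_hom J K) : bh_comp f (bh_inv f) = bh_id K.
Proof. by apply: bh_hom_inj; apply/funext => x /=; rewrite bh_invfunK. Qed.

Definition full_bh_groupoid : groupoid :=
  Groupoid bh_compA bh_comp1m bh_compm1 bh_compVm bh_compmV.

(* [O] is the set of objects; it has to be a union of components for
   [bh_groupoid] to be a Brink-Howlett groupoid. *)
Section SubGroupoid.
Variable O : set full_bh_groupoid.

Definition bh_groupoid : groupoid := full_subgroupoid O.

Definition root_act_fun (J K : bh_groupoid) (w : mor J K) (x : root_set) :
    root_set :=
  exist _ (bh_fun w (sval x)) (root_act (bh_group w) (svalP x)).

Lemma root_act_opp (J K : bh_groupoid) (w : mor J K) x :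
  root_act_fun w (sopp x) = sopp (root_act_fun w x).
Proof. by apply: root_inj; rewrite /= (refl_group_opp (bh_group w)). Qed.

Lemma root_act_idm (J : bh_groupoid) x : root_act_fun (idm J) x = x.
Proof. exact: root_inj. Qed.

Lemma root_act_comp (J K L : bh_groupoid) (v : mor K L) (w : mor J K) x :
  root_act_fun (mcomp v w) x = root_act_fun v (root_act_fun w x).
Proof. exact: root_inj. Qed.

Definition root_gset : signed_gset bh_groupoid :=
  @SignedGset bh_groupoid (fun=> root_set) root_act_fun
    root_act_opp root_act_idm root_act_comp.

Definition bh_generator : morphisms bh_groupoid := fun J J' w =>
  exists a : V,
    [/\ Pi a /\ ~ bh_set (sval J) a,
        finite_type (cox_component (bh_set (sval J) `|` [set a]) a),
        bh_fun w = nu a (bh_set (sval J)) &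
        bh_set (sval J') `<=` bh_set (sval J) `|` [set a]].

End SubGroupoid.
End BasedRootSystems.

(* Main.v *)
Require Import Defs.
From Stdlib Require Import Relation_Operators.
From mathcomp Require Import all_boot all_order all_algebra.
From mathcomp Require Import all_classical all_reals.
From mathcomp Require Import finmap lra.

Set Implicit Arguments.
Unset Strict Implicit.
Unset Printing Implicit Defensive.

Import Order.TTheory GRing.Theory Num.Theory.
Local Open Scope classical_set_scope.
Local Open Scope ring_scope.

(** A morphism [w] onto an object [K] is studied through the inverse group element
    [f = w^-1], which maps [K] into [Pi]; the inversion set of [w] is then the
    set [flipped f] of the positive roots that [f] makes negative.  The weak
    preorder at [K] thus becomes inclusion of the sets [flipped f], for [f] in the
    set of group elements mapping [K] into [Pi].

    The key fact is [descents_fill]: if [f] maps [K] into [Pi] and makes the elements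
    of [D] in [Pi] negative, then it makes negative every positive root of the
    parabolic subsystem of [K `|` D] that lies outside that of [K].  Hence the
    simple roots that [f] makes negative provide lower bounds of [f] that depend on
    [K] and [D] only ([lower_bound_of_descents]).

    For [D] a singleton [a] these lower bounds are the atoms.  An arbitrary [f] either
    makes [a] negative, and then all roots inverted by the atom, or keeps [K] and [a]
    positive, and then all roots inverted by the atom; this is the dichotomy of
    preprincipality.  Atoms generate because inversion sets are finite.

    For [D] a pair, two atoms with a common upper bound have a join.  A diamond
    argument ([exists_greatest]) turns this into the existence of a greatest element
    in every family of bounded height which is closed downwards and under such
    joins.  The common lower bounds of a nonempty set form such a family, which gives
    meets.  The elements below a join that keep a given simple root positive form
    another one, by extremality of simple roots; this yields the second axiom of
    rootoidality for an atom ([lub_avoids_simple]), and the general case follows by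
    composing atoms ([lub_avoids]).

    The atoms are the Brink-Howlett generators because elements of the group are
    determined by their sets [flipped].  If the component [L] of [a] in
    [J `|` [set a]] is of finite type, then the product of longest elements
    [nu a J] makes negative exactly the positive roots gained from [a]
    ([flipped_nu]).  Conversely the set of these roots is finite for an
    atom, and then [L] is of finite type, because the remaining roots of [L] are
    proportional to differences of such roots ([component_roots_finite]).

    The passage to the real compression is formal.  The roots inverted by an atom are
    parallel by the dichotomy, so that the atoms are the morphisms inverting a
    single class of roots ([atomic_simple], [simple_atomic]); splitting off an atom
    below a morphism removes one class, and the weak preorders do not change
    ([rec_principal], [rec_rootoidal]).

    Simple roots may be linearly dependent, so coefficients of roots are not
    available; their role is taken by the extremality of simple roots
    ([simple_extreme]) and by induction on positive roots ([pos_root_ind]). *)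

(** * Signed groupoid-sets with finite inversion sets *)

Section SignedGsets.
Variables (G : groupoid) (X : signed_gset G).

Lemma inversionsE (a b : G) (g : mor b a) (x : X a) :
  inversions g x <-> spos x /\ ~ spos (act (minv g) x).
Proof.
split=> [[px [_ [y py <-] e]]|[px nx]].
  by split=> //; rewrite -e actK => /spos_opp.
split=> //; exists (act (minv g) x); last exact: actVK.
by exists (sopp (act (minv g) x)); [apply/spos_opp|rewrite soppK].
Qed.

Lemma minv_idm (a : G) : minv (idm a) = idm a.
Proof. by rewrite -(mcomp_eq1_minv (mcompm1 (idm a))). Qed.

Lemma inversions_idm (a : G) : inversions (idm a) = set0 :> set (X a).
Proof.
by apply/seteqP; split=> // x /inversionsE; rewrite minv_idm act_idm => -[].
Qed.

(** The cocycle formula, for a factor [s] of [g] that is a lower bound of [g]. *)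
Lemma inversions_quot (a b c : G) (s : mor c a) (g : mor b a) :
  inversions s `<=` @inversions _ X _ _ g ->
  inversions (mcomp (minv s) g) = act (minv s) @` (inversions g `\` inversions s)
    :> set (X c).
Proof.
move=> sg; apply/seteqP; split=> [y|_ [x [/inversionsE[px nx] sx] <-]].
  move=> /inversionsE[py]; rewrite minv_comp minvK act_comp => ny.
  exists (act s y); last by rewrite actK.
  have nsy : ~ inversions s (act s y) by move=> /inversionsE; rewrite actK => -[].
  split=> //; apply/inversionsE; split=> //; apply: contrapT => nsp.
  have /sg/inversionsE[_] : inversions s (sopp (act s y)).
    apply/inversionsE; split; first exact/spos_opp.
    by rewrite act_opp actK => /spos_opp.
  by rewrite act_opp => h; apply: h; apply/spos_opp.
apply/inversionsE; rewrite minv_comp minvK act_comp actVK; split=> //.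
by apply: contrapT => nsx; apply: sx; apply/inversionsE.
Qed.

Lemma inversions_inv (a b : G) (g : mor b a) :
  inversions (minv g) =
    (fun x => sopp (act (minv g) x)) @` inversions g :> set (X b).
Proof.
apply/seteqP; split=> [y /inversionsE[py]|_ [x /inversionsE[px nx] <-]].
  rewrite minvK => ny; exists (sopp (act g y)).
    2: by rewrite act_opp actK soppK.
  apply/inversionsE; split; first exact/spos_opp.
  by rewrite act_opp actK => /spos_opp.
apply/inversionsE; split; first exact/spos_opp.
by rewrite minvK act_opp actVK => /spos_opp.
Qed.

Lemma word_mono (C D : morphisms G) (a b : G) n (g : mor a b) :
  (forall a b (s : mor a b), C a b s -> D a b s) -> word C n g -> word D n g.
Proof.
move=> CD; elim=> {a b n g} [a|a b c n s g Cs _ IH|a b c n s g Cs _ IH].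
- exact: word_idm.
- by apply: word_comp => //; apply: CD.
- by apply: word_compV => //; apply: CD.
Qed.

Lemma word_id (C : morphisms G) (a b : G) (g : mor b a) :
  to_into g = to_into (idm a) -> word C 0 g.
Proof.
move=> e; suff: word C 0 (projT2 (to_into g)) by [].
by rewrite e; apply: word_idm.
Qed.

Lemma card_le_setD1 T (A : set T) x n : (A #<= `I_n.+1)%card -> A x ->
  (A `\ x #<= `I_n)%card.
Proof.
move=> An Ax; have finA : finite_set A by apply/finite_set_leP; exists n.+1.
have [k Ak] := (finite_setP (A `\ x)).1 (sub_finite_set (@subDsetl _ _ _) finA).
have : (A #= `I_k.+1)%card by apply/eq_cardSP; exists x.
rewrite card_eq_le => /andP[_ kA]; move: Ak; rewrite card_eq_le => /andP[Ak _].
by apply: card_le_trans Ak _; have := card_le_trans kA An; rewrite !card_le_II.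
Qed.

Lemma card_le_add1 T (A : set T) x n : (A `\ x #<= `I_n)%card ->
  (A #<= `I_n.+1)%card.
Proof.
move=> An; have [Ax|nAx] := pselect (A x); last first.
  apply: (@card_le_trans _ _ _ `I_n); last by rewrite card_le_II.
  apply: card_le_trans An; apply: subset_card_le => y Ay; split=> // e.
  by apply: nAx; rewrite -e.
have finAx : finite_set (A `\ x) by apply/finite_set_leP; exists n.
have [k Ak] := (finite_setP (A `\ x)).1 finAx.
have : (A #= `I_k.+1)%card by apply/eq_cardSP; exists x.
rewrite card_eq_le => /andP[Ak1 _]; apply: card_le_trans Ak1 _.
move: Ak; rewrite card_eq_le => /andP[_ kA].
by have := card_le_trans kA An; rewrite !card_le_II.
Qed.

Section FiniteInversions.
Hypothesis Xfaithful : faithful X.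
Hypothesis Xfinite : forall (a b : G) (g : mor b a),
  finite_set (@inversions _ X _ _ g).

Lemma inversions_eq0 (a b : G) (g : mor b a) :
  inversions g = set0 :> set (X a) -> to_into g = to_into (idm a).
Proof.
by move=> e; apply: Xfaithful; rewrite /into_inversions/= e inversions_idm.
Qed.

(** Among the finitely many inversion sets below that of [g] there is a minimal
    nonempty one. *)
Lemma atom_below (a b : G) (g : mor b a) : to_into g <> to_into (idm a) ->
  exists c (s : mor c a), atomic X s /\ wle X (to_into s) (to_into g).
Proof.
have [n gn] := (finite_set_leP _).1 (Xfinite g).
elim: n b g gn => [|n IH] b g gn g1.
  case: g1; apply: inversions_eq0; apply/card_le0P.
  by rewrite (card_le_trans gn)// II0.
have [ag|nag] := pselect (atomic X g); first by exists b, g; split.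
have [[c h] [hg h1 hng]] : exists h : into a,
    [/\ wle X h (to_into g), h <> to_into (idm a) & h <> to_into g].
  apply: contrapT => nh; apply: nag; split=> // h hg.
  by apply: contrapT => /not_orP[h1 h2]; apply: nh; exists h.
have [x gx hx] : exists2 x : X a, inversions g x & ~ inversions h x.
  apply: contrapT => nx; apply: hng; apply: Xfaithful.
  apply/seteqP; split=> // x gx.
  by apply: contrapT => hx; apply: nx; exists x.
have [|d [s [as_ sh]]] := IH c h _ h1.
  apply: card_le_trans (card_le_setD1 gn gx); apply: subset_card_le => y hy.
  by split; [exact: hg|move=> e; apply: hx; rewrite -e].
by exists d, s; split=> //; apply: subset_trans sh hg.
Qed.

(** Splitting off an atom below [g] removes at least one inversion. *)
Lemma atomic_word (a b : G) (g : mor b a) n :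
  (@inversions _ X _ _ g #<= `I_n)%card ->
  exists2 m, (m <= n)%N & word (@atomic _ X) m g.
Proof.
elim: n b a g => [|n IH] b a g gn.
  exists 0%N => //; apply/word_id/inversions_eq0/card_le0P.
  by rewrite (card_le_trans gn)// II0.
have [g1|g1] := pselect (to_into g = to_into (idm a)).
  by exists 0%N => //; apply: word_id.
have [c [s [as_ sg]]] := atom_below g1.
have [x sx] : exists x, @inversions _ X _ _ s x.
  apply/set0P; apply/eqP => s0; case: as_ => s1 _; apply: s1.
  exact: inversions_eq0.
have [|m mn hm] := IH _ _ (mcomp (minv s) g).
  rewrite inversions_quot//; apply: card_le_trans (card_image_le _ _) _.
  apply: card_le_trans (card_le_setD1 gn (sg _ sx)); apply: subset_card_le.
  by move=> y [gy sy]; split=> // e; apply: sy; rewrite e.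
exists m.+1 => //; rewrite -[g]mcomp1m -(mcompmV s) -mcompA.
exact: word_comp.
Qed.

End FiniteInversions.
End SignedGsets.

(** * Real compression of a preprincipal signed groupoid-set *)

Section Compression.
Variables (G : groupoid) (X : signed_gset G).
Let Y := real_compression X.

Lemma rec_inversions (a b : G) (g : mor b a) (x : X a) (rx : real_root x) :
  @inversions _ Y _ _ g (to_rec rx) <-> inversions g x.
Proof.
rewrite !inversionsE /= rec_act_class; split=> -[px nx]; split.
- exact/(rec_pos_class rx).
- by move=> sx; apply: nx; apply/rec_pos_class.
- exact/(rec_pos_class rx).
- by move=> /rec_pos_class.
Qed.

Lemma inversions_real (a b : G) (g : mor b a) (x : X a) :
  inversions g x -> real_root x.
Proof. by move=> /inversionsE[px nx]; exists b, g => -[_ /(_ px)]. Qed.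

(** Inversions are real roots, hence the weak preorders are not affected. *)
Lemma wle_rec (a : G) (g h : into a) : @wle _ Y a g h <-> wle X g h.
Proof.
split=> gh; last first.
  by elim/rec_ind => x rx /rec_inversions/gh/rec_inversions-/(_ rx).
move=> x gx; have rx := inversions_real gx.
exact/(rec_inversions _ rx)/gh/rec_inversions.
Qed.

Lemma rec_meet (a : G) (P : set (into a)) m : is_meet Y P m <-> is_meet X P m.
Proof.
split=> -[mP mmax]; split=> [p Pp|l lP].
- exact/wle_rec/mP.
- by apply/wle_rec/mmax => p Pp; apply/wle_rec/lP.
- exact/wle_rec/mP.
- by apply/wle_rec/mmax => p Pp; apply/wle_rec/lP.
Qed.

Lemma rec_join (a : G) (P : set (into a)) j : is_join Y P j <-> is_join X P j.
Proof.
split=> -[jP jmin]; split=> [p Pp|u uP].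
- exact/wle_rec/jP.
- by apply/wle_rec/jmin => p Pp; apply/wle_rec/uP.
- exact/wle_rec/jP.
- by apply/wle_rec/jmin => p Pp; apply/wle_rec/uP.
Qed.

Lemma rec_disjoint (a : G) (g h : into a) :
  @into_inversions _ Y a g `&` into_inversions h = set0 <->
  @into_inversions _ X a g `&` into_inversions h = set0.
Proof.
split=> e; apply/seteqP; split=> //; last first.
  elim/rec_ind => x rx [/rec_inversions gx /rec_inversions hx].
  by have : (set0 : set (X a)) x by rewrite -e; split.
move=> x [gx hx]; have rx := inversions_real gx.
have : (set0 : set (Y a)) (to_rec rx) by rewrite -e; split; apply/rec_inversions.
by [].
Qed.

Lemma rec_faithful : faithful X -> faithful Y.
Proof.
move=> fX a g h e; apply: fX; apply/seteqP; split; apply/wle_rec;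
  by rewrite /wle e.
Qed.

Lemma rec_rootoidal : rootoidal X -> rootoidal Y.
Proof.
move=> [fX rX]; split=> [|a]; first exact: rec_faithful.
have [meets joins] := rX a; split=> [P /meets[m Pm]|P q j Pq /rec_join Pj].
  by exists m; apply/rec_meet.
by apply/rec_disjoint; apply: (joins P) => // p Pp; apply/rec_disjoint; apply: Pq.
Qed.

Lemma rec_atomic (a b : G) (g : mor b a) : atomic Y g <-> atomic X g.
Proof.
by split=> -[g1 gmin]; split=> // h /wle_rec; apply: gmin.
Qed.

Hypothesis Xpre : preprincipal X.

Let Xfaithful : faithful X. Proof. by case: Xpre. Qed.

Let Yfaithful : faithful Y. Proof. exact: rec_faithful. Qed.

(** By the dichotomy every inversion set contains all inversions of [s] or none, which
    makes them parallel. *)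
Lemma atomic_simple (a b : G) (s : mor b a) : atomic X s -> simple Y s.
Proof.
move=> as_; have [_ _ dich] := Xpre.
have [x sx] : exists x, @inversions _ X _ _ s x.
  apply/set0P; apply/eqP => s0; case: as_ => s1 _; apply: s1.
  exact: inversions_eq0 Xfaithful _ _ _ s0.
have rx := inversions_real sx.
suff e : @inversions _ Y _ _ s = [set to_rec rx] by rewrite /simple e card_set1.
apply/seteqP; split=> [|_ ->]; last exact/rec_inversions.
elim/rec_ind => y ry /rec_inversions sy; apply/to_rec_eq => c g.
have [px _] := sx; have [py _] := sy; have inv_iff z : spos z ->
    (spos (act (minv g) z) <-> ~ @inversions _ X _ _ g z).
  move=> pz; rewrite inversionsE; split=> [h []//|nz].
  by apply: contrapT => h; apply: nz.
rewrite /same_sign (inv_iff _ px) (inv_iff _ py).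
have [sg|/seteqP[sg _]] := dich a c b g s as_.
  by split=> h; case: h; exact: sg.
by split=> _ h; [apply: (sg x)|apply: (sg y)].
Qed.

Lemma simple_atomic (a b : G) (s : mor b a) : simple Y s -> atomic X s.
Proof.
move=> /eq_cardSP[x sx]; rewrite II0 card_eq0 => /eqP s0; split.
  move=> e; have : @into_inversions _ Y a (to_into s) x by [].
  by rewrite e /into_inversions /= inversions_idm.
move=> h /wle_rec hs; have [hx|hx] := pselect (@into_inversions _ Y a h x).
  right; apply: Yfaithful; apply/seteqP; split=> // y sy.
  have [->//|yx] := pselect (y = x).
  by have : (@inversions _ Y _ _ s `\ x) y by []; rewrite s0.
left; case: h hs hx => c h hs hx; apply: (@inversions_eq0 _ Y Yfaithful a c h).
apply/seteqP; split=> // y hy; rewrite -s0; split; first exact: hs.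
by move=> yx; apply: hx; rewrite -yx.
Qed.

Lemma simple_inv (a b : G) (s : mor b a) : simple Y s -> simple Y (minv s).
Proof.
rewrite /simple inversions_inv => h; apply: card_eq_trans h.
apply: inj_card_eq => x y _ _ /(congr1 (@sopp (Y b))); rewrite !soppK.
exact: (can_inj (actVK _)).
Qed.

Lemma atomic_inv (a b : G) (s : mor b a) : atomic X s -> atomic X (minv s).
Proof. by move=> /atomic_simple/simple_inv/simple_atomic. Qed.

(** By the cocycle property a simple factor adds at most one class of inversions. *)
Lemma word_card (a b : G) n (g : mor b a) : word (@simple _ Y) n g ->
  (@inversions _ Y _ _ g #<= `I_n)%card.
Proof.
have step c d e m (s : mor d e) (h : mor c d) : simple Y s ->
    (@inversions _ Y _ _ h #<= `I_m)%card ->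
    (@inversions _ Y _ _ (mcomp s h) #<= `I_m.+1)%card.
  move=> /eq_cardSP[x sx]; rewrite II0 card_eq0 => /eqP s0 hm.
  apply: (@card_le_add1 _ _ x); apply: card_le_trans hm.
  apply: card_le_trans (card_image_le (act s) _); apply: subset_card_le.
  move=> y [/inversionsE[py ny] yx]; exists (act (minv s) y); last exact: actVK.
  apply/inversionsE; rewrite minv_comp act_comp in ny; split=> //.
  apply: contrapT => nsy.
  have : (@inversions _ Y _ _ s `\ x) y by split=> //; apply/inversionsE.
  by rewrite s0.
elim=> {a b n g} [a|a b c n s g ss _ IH|a b c n s g ss _ IH].
- by rewrite inversions_idm card_ge0.
- exact: step.
- by apply: step => //; apply: simple_inv.
Qed.

(** The number of inversions bounds the length from below by [word_card] and from above
    by [atomic_word]. *)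
Lemma rec_principal : principal Y /\
  forall (a b : G) (s : mor b a), simple Y s <-> atomic X s.
Proof.
have sa (a b : G) (s : mor b a) : simple Y s <-> atomic X s.
  by split; [apply: simple_atomic|apply: atomic_simple].
split=> //; have [_ gen _] := Xpre.
have genY : generates (@simple _ Y).
  move=> a b g; have [n gn] := gen a b g; exists n.
  by apply: word_mono gn => c d s; apply: atomic_simple.
have finY (a b : G) (g : mor b a) : finite_set (@inversions _ Y _ _ g).
  by have [n /word_card gn] := genY _ _ g; apply/finite_set_leP; exists n.
split=> // b a g; have [n gn] := (finite_setP _).1 (finY _ _ g).
exists n; split=> //; have := gn; rewrite card_eq_le => /andP[gn1 gn2].
have minn m : word (@simple _ Y) m g -> (n <= m)%N.
  by move=> /word_card gm; rewrite -card_le_II; apply: card_le_trans gn2 gm.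
have [m mn gm] := atomic_word Yfaithful finY gn1.
have {}gm : word (@simple _ Y) m g.
  by apply: word_mono gm => c d s /rec_atomic/atomic_simple.
by split=> //; have -> : n = m by apply/eqP; rewrite eqn_leq mn minn.
Qed.

End Compression.

(** * Cones *)

Section Cones.
Variables (R : realType) (V : lmodType R).
Implicit Types (A : set V) (u v : V) (c : R).

Lemma cone_ind A (P : V -> Prop) :
  P 0 -> (forall c x v, 0 <= c -> A x -> P v -> P (c *: x + v)) ->
  forall v, cone A v -> P v.
Proof.
move=> P0 PS v [n [c [x [c0 Ax ->]]]].
elim: n c x c0 Ax => [|n IH] c x c0 Ax; first by rewrite big_ord0.
by rewrite big_ord_recl; apply: PS => //; apply: IH.
Qed.

Lemma cone0 A : cone A 0.
Proof. by exists 0%N, (fun=> 0), (fun=> 0); split=> [[]|[]|] //; rewrite big_ord0. Qed.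

Lemma cone_step A c x v : 0 <= c -> A x -> cone A v -> cone A (c *: x + v).
Proof.
move=> c0 Ax [n [d [y [d0 Ay ->]]]].
exists n.+1, (fun i => oapp d c (unlift ord0 i)),
  (fun i => oapp y x (unlift ord0 i)).
split=> [i|i|]; [by case: (unlift _ i) => /=|by case: (unlift _ i) => /=|].
rewrite big_ord_recl unlift_none /=; congr (_ + _).
by apply: eq_bigr => i _; rewrite liftK.
Qed.

Lemma coneD A u v : cone A u -> cone A v -> cone A (u + v).
Proof.
move=> cu cv; move: u cu; apply: cone_ind => [|c x u c0 Ax IH].
  by rewrite add0r.
by rewrite -addrA; apply: cone_step.
Qed.

Lemma coneZ A c v : 0 <= c -> cone A v -> cone A (c *: v).
Proof.
move=> c0; move: v; apply: cone_ind => [|d x v d0 Ax IH].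
  by rewrite scaler0; apply: cone0.
by rewrite scalerDr scalerA; apply: cone_step => //; apply: mulr_ge0.
Qed.

Lemma cone_gen A x : A x -> cone A x.
Proof.
by move=> Ax; rewrite -[x]addr0 -[x in x + _]scale1r; apply: cone_step (cone0 _).
Qed.

(** Separating the generator [a] from the others; the two summands are not
    unique when the generators are linearly dependent. *)
Lemma cone_split A a v : cone A v ->
  exists k r, [/\ 0 <= k, cone (A `\ a) r & v = k *: a + r].
Proof.
move: v; apply: cone_ind => [|c x v c0 Ax [k [r [k0 Ar ->]]]].
  by exists 0, 0; split=> //; [apply: cone0|rewrite scale0r addr0].
have [xa|xa] := pselect (x = a).
  exists (c + k), r; split=> //; first exact: addr_ge0.
  by rewrite xa scalerDl addrA.
exists k, (c *: x + r); split=> //; first exact: cone_step.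
by rewrite addrCA.
Qed.

Lemma cone_sub A A' : A `<=` A' -> cone A `<=` cone A'.
Proof.
move=> AA; apply: cone_ind => [|c x v c0 Ax IH]; first exact: cone0.
by apply: cone_step => //; apply: AA.
Qed.

End Cones.

(** * The form and its reflections *)

Section Roots.
Variables (R : realType) (V : lmodType R) (B : {symmetric V}).
Implicit Types (A M J K : set V) (u v a b d : V) (c : R) (f g h : V -> V)
  (s : seq V).

Lemma formC u v : B u v = B v u.
Proof. by rewrite hermC expr0 mul1r. Qed.

Lemma formDl u v w : B (u + v) w = B u w + B v w.
Proof. exact: linearDl. Qed.

Lemma formZl c u w : B (c *: u) w = c * B u w.
Proof. exact: linearZl_LR. Qed.

Lemma formNl u w : B (- u) w = - B u w.
Proof. exact: linearNl. Qed.

Lemma formDr u v w : B w (u + v) = B w u + B w v.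
Proof. by rewrite formC formDl !(formC w). Qed.

Lemma formZr c u w : B w (c *: u) = c * B w u.
Proof. by rewrite formC formZl formC. Qed.

Lemma formNr u w : B w (- u) = - B w u.
Proof. by rewrite formC formNl formC. Qed.

Variables Phi Pi : set V.
Hypothesis brs : based_root_system B Phi Pi.

Notation refl := (refl B).
Notation refl_group := (refl_group B).
Notation refl_word := (refl_word B).

Lemma cone_pointed u v : cone Pi u -> cone Pi v -> u + v = 0 -> u = 0.
Proof.
move=> cu cv e; have: (cone Pi `&` cone (oppset Pi)) u.
  split=> //; have -> : u = - v by apply/eqP; rewrite -addr_eq0 e.
  exact/cone_opp.
by rewrite (brs_pointed brs).
Qed.

Lemma simple_norm a : Pi a -> B a a = 1.
Proof. exact: (brs_unit brs). Qed.

Lemma reflE a v : B a a = 1 -> refl a v = v - (2 * B v a) *: a.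
Proof. by move=> e; rewrite /Defs.refl e divr1. Qed.

Lemma refl_linear a c u v : refl a (c *: u + v) = c *: refl a u + refl a v.
Proof.
rewrite /Defs.refl formDl formZl scalerBr !scalerA addrACA -opprD -scalerDl.
by congr (_ - _ *: _); rewrite mulrDr mulrDl mulrCA !mulrA.
Qed.

Lemma refl_invol a v : B a a = 1 -> refl a (refl a v) = v.
Proof.
move=> e; rewrite !reflE// formDl formNl formZl e mulr1.
have -> : 2 * (B v a - 2 * B v a) = - (2 * B v a) by lra.
by rewrite scaleNr opprK subrK.
Qed.

Lemma refl_form a u v : B a a = 1 -> B (refl a u) (refl a v) = B u v.
Proof.
move=> e; rewrite !reflE// !(formDl, formDr, formNl, formNr, formZl, formZr) e.
rewrite (formC a v); lra.
Qed.

(** * Words and the groups they generate *)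

Lemma refl_group_sub J M : J `<=` M -> refl_group J `<=` refl_group M.
Proof.
move=> JM f; elim=> {f} [|a Ja|f g _ Mf _ Mg|f g _ Mf fg gf].
- exact: refl_group_id.
- by apply: refl_group_refl; apply: JM.
- exact: refl_group_comp.
- exact: refl_group_inv gf.
Qed.

Section GroupElements.
Variable M : set V.
Hypothesis MPi : M `<=` Pi.

Lemma refl_word_cat s1 s2 : refl_word (s1 ++ s2) = refl_word s1 \o refl_word s2.
Proof. by elim: s1 => //= a s ->. Qed.

Lemma refl_word_rcons s a : refl_word (rcons s a) = refl_word s \o refl a.
Proof. by rewrite -cats1 refl_word_cat. Qed.

Lemma refl_word_group s : (forall a, a \in s -> M a) -> refl_group M (refl_word s).
Proof.
elim: s => [_|a s IH sM] /=; first exact: refl_group_id.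
apply: refl_group_comp; first by apply/refl_group_refl/sM/mem_head.
by apply: IH => b bs; apply: sM; rewrite in_cons bs orbT.
Qed.

Lemma refl_word_rev s : (forall a, a \in s -> M a) ->
  cancel (refl_word s) (refl_word (rev s)).
Proof.
elim: s => [_ v//|a s IH sM v].
rewrite rev_cons refl_word_rcons /= refl_invol.
  2: exact/simple_norm/MPi/sM/mem_head.
by apply: IH => b bs; apply: sM; rewrite in_cons bs orbT.
Qed.

Lemma refl_groupP f : refl_group M f ->
  exists2 s, (forall a, a \in s -> M a) & f = refl_word s.
Proof.
elim=> {f} [|a Ma|f g _ [s sM ->] _ [t tM ->]|f g _ [s sM ->] fg gf].
- by exists [::].
- by exists [:: a] => // b; rewrite inE => /eqP ->.
- exists (s ++ t); last by rewrite refl_word_cat.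
  by move=> a; rewrite mem_cat => /orP[/sM|/tM].
- exists (rev s); first by move=> a; rewrite mem_rev => /sM.
  by apply/funext => v; rewrite -[in RHS](gf v) refl_word_rev.
Qed.

End GroupElements.

(** A total operation on functions, so that inverses can be written without proofs of
    membership in the group. *)
Definition ginv f : V -> V := xget (id : V -> V) [set g | cancel f g /\ cancel g f].

Lemma ginv_spec f : refl_group Pi f ->
  [/\ refl_group Pi (ginv f), cancel f (ginv f) & cancel (ginv f) f].
Proof.
move=> Wf; have [g [Wg fg gf]] := refl_group_bij brs Wf.
suff -> : ginv f = g by [].
have [fi jf] : cancel f (ginv f) /\ cancel (ginv f) f.
  exact: (@xgetPex _ (id : V -> V) [set h | cancel f h /\ cancel h f])
           (ex_intro _ g (conj fg gf)).
by apply/funext => v; rewrite -[in LHS](gf v) fi.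
Qed.

Lemma ginv_group f : refl_group Pi f -> refl_group Pi (ginv f).
Proof. by case/ginv_spec. Qed.

Lemma ginvK f : refl_group Pi f -> cancel f (ginv f).
Proof. by case/ginv_spec. Qed.

Lemma ginvVK f : refl_group Pi f -> cancel (ginv f) f.
Proof. by case/ginv_spec. Qed.

Lemma ginv_in_group M f : M `<=` Pi -> refl_group M f -> refl_group M (ginv f).
Proof.
move=> MPi Mf; have Wf := refl_group_sub MPi Mf.
by apply: refl_group_inv Mf _ _; [apply: ginvK|apply: ginvVK].
Qed.

Lemma group_linear f c u v : refl_group Pi f ->
  f (c *: u + v) = c *: f u + f v.
Proof.
move=> Wf; elim: Wf c u v => {f} [//|a _|f g _ hf _ hg|f g _ hf fg gf] c u v.
- exact: refl_linear.
- by rewrite /= hg hf.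
- by apply: (can_inj fg); rewrite hf !gf.
Qed.

Lemma groupD f u v : refl_group Pi f -> f (u + v) = f u + f v.
Proof. by move=> Wf; rewrite -{1}[u]scale1r group_linear// scale1r. Qed.

Lemma groupN f v : refl_group Pi f -> f (- v) = - f v.
Proof. by move=> Wf; apply: (refl_group_opp Wf). Qed.

Lemma group0 f : refl_group Pi f -> f 0 = 0.
Proof. by move=> Wf; apply: (addrI (f 0)); rewrite -groupD// !addr0. Qed.

Lemma groupZ f c v : refl_group Pi f -> f (c *: v) = c *: f v.
Proof. by move=> Wf; rewrite -[c *: v]addr0 group_linear// group0// !addr0. Qed.

Lemma groupB f u v : refl_group Pi f -> f (u - v) = f u - f v.
Proof. by move=> Wf; rewrite groupD// groupN. Qed.

Lemma group_form f u v : refl_group Pi f -> B (f u) (f v) = B u v.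
Proof.
move=> Wf; elim: Wf u v => {f} [//|a Pa|f g _ hf _ hg|f g _ hf fg gf] u v.
- exact/refl_form/simple_norm.
- by rewrite /= hf hg.
- by rewrite -(hf (g u)) !gf.
Qed.

Lemma refl_conj f a v : refl_group Pi f -> f (refl a v) = refl (f a) (f v).
Proof. by move=> Wf; rewrite /Defs.refl groupB// groupZ// !group_form. Qed.

(** [roots_of M] is the root system of the parabolic subgroup generated by [M]. *)
Definition roots_of M : set V :=
  [set v | exists w a, [/\ refl_group M w, M a & v = w a]].

Lemma roots_of_Pi : roots_of Pi = Phi.
Proof. by rewrite (brs_roots brs). Qed.

Lemma roots_of_gen M a : M a -> roots_of M a.
Proof. by exists id, a; split=> //; apply: refl_group_id. Qed.

Lemma roots_of_sub J M : J `<=` M -> roots_of J `<=` roots_of M.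
Proof.
move=> JM _ [w [a [Jw Ja ->]]]; exists w, a; split=> //; last exact: JM.
exact: refl_group_sub Jw.
Qed.

Lemma roots_of_act M f v : refl_group M f -> roots_of M v -> roots_of M (f v).
Proof.
move=> Mf [w [a [Mw Ma ->]]]; exists (f \o w), a; split=> //.
exact: refl_group_comp.
Qed.

Lemma roots_of_opp M v : M `<=` Pi -> roots_of M v -> roots_of M (- v).
Proof.
move=> MPi [w [a [Mw Ma ->]]].
exists (w \o refl a), a; split=> //.
  by apply: refl_group_comp => //; apply: refl_group_refl.
have Wa := refl_group_sub MPi Mw.
by rewrite /= (refl_self brs (MPi _ Ma)) groupN.
Qed.

Lemma roots_of_oppE M v : M `<=` Pi -> roots_of M (- v) -> roots_of M v.
Proof. by move=> MPi /(roots_of_opp MPi); rewrite opprK. Qed.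

Lemma roots_of_actE M f v : M `<=` Pi -> refl_group M f ->
  roots_of M (f v) -> roots_of M v.
Proof.
move=> MPi Mf /(roots_of_act (ginv_in_group MPi Mf)).
by rewrite ginvK//; apply: refl_group_sub Mf.
Qed.

Lemma root_form M v : M `<=` Pi -> roots_of M v -> B v v = 1.
Proof.
move=> MPi [w [a [Mw Ma ->]]].
by rewrite group_form; [apply/simple_norm/MPi|apply: refl_group_sub Mw].
Qed.

Lemma root_refl M b : M `<=` Pi -> roots_of M b -> refl_group M (refl b).
Proof.
move=> MPi [w [a [Mw Ma ->]]]; have Ww := refl_group_sub MPi Mw.
suff -> : refl (w a) = w \o refl a \o ginv w.
  apply: refl_group_comp; last exact: ginv_in_group.
  by apply: refl_group_comp => //; apply: refl_group_refl.
by apply/funext => v /=; rewrite refl_conj// ginvVK.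
Qed.

(** * Positive roots *)

Definition pos v := Phi v /\ cone Pi v.

Lemma Phi_act f v : refl_group Pi f -> Phi v -> Phi (f v).
Proof. exact: root_act. Qed.

Lemma root_pos_or v : Phi v -> pos v \/ pos (- v).
Proof.
move=> Pv; have := Pv; rewrite {1}(brs_signs brs) => -[[_ ?]|[_ h]].
  by left.
right; split; first exact: root_opp brs _ Pv.
by apply/cone_opp; rewrite opprK.
Qed.

Lemma pos_not_neg v : pos v -> ~ pos (- v).
Proof.
move=> [Pv cv] [_ cnv]; apply: (root_neq0 brs Pv).
by apply: cone_pointed cv cnv _; rewrite subrr.
Qed.

Lemma neg_of_not_pos v : Phi v -> ~ pos v -> pos (- v).
Proof. by case/root_pos_or. Qed.

Lemma pos_simple a : Pi a -> pos a.
Proof.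
move=> Pa; split; last exact: cone_gen.
by rewrite -roots_of_Pi; apply: roots_of_gen.
Qed.

Lemma pos_form v : pos v -> B v v = 1.
Proof. by rewrite /pos -roots_of_Pi => -[/root_form -> //]. Qed.

(** Comparing coefficients of [a] gives [k a = r'] with [r'] in the cone of the other
    simple roots.  Extremality of [a] excludes [k > 0], and otherwise pointedness
    shows that [q] is a multiple of [a]. *)
Lemma simple_extreme a r y q :
  Pi a -> cone Pi r -> pos q -> 0 < y -> a = r + y *: q -> q = a.
Proof.
move=> Pa cr pq y0 e.
have [k1 [r1 [k10 cr1 er]]] := cone_split a cr.
have [k2 [r2 [k20 cr2 eq]]] := cone_split a pq.2.
have sub := @cone_sub _ _ _ _ (@subDsetl _ Pi [set a]).
pose k := 1 - k1 - y * k2.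
have ek : k *: a = r1 + y *: r2.
  have -> : r1 = r - k1 *: a by rewrite er addrAC subrr add0r.
  have -> : r2 = q - k2 *: a by rewrite eq addrAC subrr add0r.
  by rewrite scalerBr scalerA addrACA -opprD -e !scalerBl scale1r opprD addrA.
have cr12 : cone (Pi `\ a) (r1 + y *: r2).
  by apply: coneD => //; apply: coneZ => //; apply: ltW.
have [kpos|kneg] := ltP 0 k.
  case: (brs_extreme brs Pa).
  suff: cone (Pi `\ a) (k^-1 *: (r1 + y *: r2)).
    by rewrite -ek scalerA mulVf ?scale1r// gt_eqF.
  by apply: coneZ => //; rewrite invr_ge0 ltW.
have r20 : y *: r2 = 0.
  apply: (@cone_pointed _ ((- k) *: a + r1)).
  - by apply: coneZ; [apply: ltW|apply: sub cr2].
  - by apply: cone_step => //; [rewrite oppr_ge0|apply: sub cr1].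
  - by rewrite addrCA [_ + r1]addrC -ek scaleNr addNr.
have qa : q = k2 *: a.
  rewrite eq; move/eqP: r20; rewrite scaler_eq0 gt_eqF//= => /eqP ->.
  by rewrite addr0.
have /eqP := pos_form pq; rewrite qa formZl formZr simple_norm// mulr1 -expr2.
by rewrite sqrf_eq1 => /orP[/eqP ->|/eqP k2N]; [rewrite scale1r|exfalso; lra].
Qed.

Lemma pos_comb x y p q u : Phi u -> 0 <= x -> 0 <= y -> pos p -> pos q ->
  u = x *: p + y *: q -> pos u.
Proof.
move=> Pu x0 y0 [_ cp] [_ cq] e; split=> //; rewrite e.
by apply: coneD; apply: coneZ.
Qed.

(** If the reflected root were negative, then [b] plus a positive root would be a
    multiple of [a], which contradicts extremality or pointedness according to
    the sign of the factor. *)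
Lemma pos_refl a b : Pi a -> pos b -> b <> a -> pos (refl a b).
Proof.
move=> Pa pb ba; have Wa := refl_group_refl B Pa.
apply: contrapT => /neg_of_not_pos-/(_ (Phi_act Wa pb.1)) pn.
have e : (2 * B b a) *: a = b + - refl a b.
  by rewrite reflE ?simple_norm// opprB addrCA subrr addr0.
have [c0|c0] := ltP 0 (2 * B b a).
  apply: ba; apply: (@simple_extreme a ((2 * B b a)^-1 *: - refl a b)
                       (2 * B b a)^-1) => //.
  - by apply: coneZ pn.2; rewrite invr_ge0 ltW.
  - by rewrite invr_gt0.
  - by rewrite -scalerDr addrC -e scalerA mulVf ?scale1r// gt_eqF.
apply: (root_neq0 brs pb.1).
apply: (@cone_pointed _ (- refl a b + (- (2 * B b a)) *: a)).
- exact: pb.2.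
- apply: coneD pn.2 _; apply: coneZ; first by rewrite oppr_ge0.
  exact: cone_gen.
- by rewrite addrA -e scaleNr subrr.
Qed.

Lemma neg_refl a b : Pi a -> pos b -> pos (- refl a b) -> b = a.
Proof.
move=> Pa pb pn; apply: contrapT => ba.
exact: pos_not_neg (pos_refl Pa pb ba) pn.
Qed.

(** A sign change along a word has to happen at some letter, and that letter can then
    be deleted. *)
Lemma exchange M s b : M `<=` Pi -> (forall a, a \in s -> M a) ->
  pos b -> pos (- refl_word s b) ->
  roots_of M b /\ exists t, [/\ forall a, a \in t -> M a, size s = (size t).+1 &
                          refl_word s \o refl b = refl_word t].
Proof.
move=> MPi; elim: s => [_ pb /(pos_not_neg pb)//|a s IH asM pb pn].
have Ma : M a by apply/asM/mem_head.
have sM x : x \in s -> M x by move=> xs; apply: asM; rewrite in_cons xs orbT.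
have Ms := refl_word_group sM; have Ws := refl_group_sub MPi Ms.
have [ps|ns] := root_pos_or (Phi_act Ws pb.1); last first.
  have [Mb [t [tM st et]]] := IH sM pb ns.
  split=> //; exists (a :: t); split=> [x||]; last 2 first.
  - by rewrite /= st.
  - by apply/funext => v; congr (refl a _); exact: (congr1 (fun f => f v) et).
  by rewrite in_cons => /orP[/eqP ->//|/tM].
have ea := neg_refl (MPi _ Ma) ps pn.
split; first by apply: (roots_of_actE MPi Ms); rewrite ea; apply: roots_of_gen.
exists s; split=> //; apply/funext => v /=.
by rewrite refl_conj// ea refl_invol//; apply/simple_norm/MPi.
Qed.

(** If the last letter of a word is not a descent, then the exchange property deletes it
    together with another letter. *)
Lemma group_descent M f : M `<=` Pi -> refl_group M f ->
  f = id \/ exists2 d, M d & pos (- f d).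
Proof.
move=> MPi /(refl_groupP MPi)[s].
have [n] := ubnP (size s); elim: n s f => // n IH s f; case/lastP: s => [|s d].
  by left.
rewrite ltnS size_rcons => sn sM ->.
have Md : M d by apply: sM; rewrite mem_rcons mem_head.
have asM a : a \in s -> M a by move=> h; apply: sM; rewrite mem_rcons in_cons h orbT.
have Ws := refl_group_sub MPi (refl_word_group asM).
rewrite refl_word_rcons; have pd := pos_simple (MPi _ Md).
have [ps|ns] := root_pos_or (Phi_act Ws pd.1).
  by right; exists d; rewrite //= (refl_self brs (MPi _ Md)) groupN// opprK.
have [_ [t [tM st ->]]] := exchange MPi asM pd ns.
by apply: (IH t) => //; apply: ltnW; rewrite -st.
Qed.

(** Induction on the positive roots of a parabolic subgroup: a root that is not
    simple is the image of one of smaller depth, and exceeds it by a positive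
    multiple of a simple root.  The depth is measured by the length of the
    reflection in the root. *)
Lemma pos_root_ind M (P : V -> Prop) : M `<=` Pi ->
  (forall a, M a -> P a) ->
  (forall b d, M d -> roots_of M b -> pos b -> B b d < 0 -> pos (refl d b) ->
     P b -> P (refl d b)) ->
  forall b, roots_of M b -> pos b -> P b.
Proof.
move=> MPi Pgen Pstep b rb; have Mr := root_refl MPi rb.
have [s] := refl_groupP MPi Mr.
have [n] := ubnP (size s); elim: n s b rb {Mr} => // n IH s b rb sn sM es pb.
have Mr := root_refl MPi rb; have Wr := refl_group_sub MPi Mr.
have bb := pos_form pb.
have [e|[d Md nd]] := group_descent MPi Mr.
  have eb : refl b b = - b.
    by rewrite reflE// bb mulr1 scaler_nat mulr2n opprD addNKr.
  case: (@pos_not_neg b) => //; by rewrite -eb e.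
have Pd := MPi _ Md; have pd := pos_simple Pd; have Wd := refl_group_refl B Pd.
have [->|bd] := pselect (b = d); first exact: Pgen.
have bd0 : 0 < B b d.
  rewrite ltNge; apply/negP => bd0; apply: pos_not_neg nd.
  apply: (@pos_comb 1 (- (2 * B d b)) d b) => //.
  - exact: Phi_act Wr pd.1.
  - by rewrite formC; lra.
  - by rewrite reflE// scale1r scaleNr.
have pb' := pos_refl Pd pb bd.
have bK := refl_invol b (simple_norm Pd).
have nsd : pos (- refl_word s d) by rewrite -es.
have [_ [t [tM st et]]] := exchange MPi sM pd nsd.
have ert v : refl_word (rev t) v = refl d (refl b v).
  rewrite -[RHS](refl_word_rev MPi tM) -et -es /=.
  by rewrite (refl_invol _ (simple_norm Pd)) (refl_invol _ bb).
have rtM a : a \in rev t -> M a by rewrite mem_rev => /tM.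
have ndb : pos (- refl_word (rev t) d).
  rewrite ert -(refl_opp B); apply: pos_refl => // e; apply: bd.
  have ebd : refl b d = - d by rewrite -[in RHS]e opprK.
  apply: (@simple_extreme d 0 (B b d)) => //; first exact: cone0.
  have e2 : (2 * B b d) *: b = d + d.
    by rewrite -{3}[d]opprK -ebd reflE// formC opprB addrC subrK.
  have -> : B b d = 2^-1 * (2 * B b d) by rewrite mulrA mulVf ?mul1r ?pnatr_eq0.
  by rewrite add0r -scalerA e2 -mulr2n -scaler_nat scalerA mulVf
    ?scale1r ?pnatr_eq0.
have [_ [u [uM su eu]]] := exchange MPi rtM pd ndb.
rewrite -bK; apply: Pstep => //; rewrite ?bK//.
- by apply: roots_of_act => //; apply: refl_group_refl.
- by rewrite -(group_form _ _ Wd) bK (refl_self brs Pd) formNr oppr_lt0.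
apply: (IH u) => //.
- by apply: roots_of_act => //; apply: refl_group_refl.
- have su' : size t = (size u).+1 by rewrite -size_rev.
  by move: sn; rewrite st su' ltnS; apply: ltnW.
apply/funext => v; rewrite -eu /= ert -{1}[v](refl_invol _ (simple_norm Pd)).
by rewrite -!refl_conj.
Qed.

Lemma refl_simpleE b d : Pi d -> refl d b = b + (- (2 * B b d)) *: d.
Proof. by move=> Pd; rewrite reflE ?simple_norm// scaleNr. Qed.

(** A root that is not a generator is a positive combination of a generator and a root
    of smaller depth. *)
Lemma pos_of_generators M f b : M `<=` Pi -> refl_group Pi f ->
  (forall d, M d -> pos (f d)) -> roots_of M b -> pos b -> pos (f b).
Proof.
move=> MPi Wf fM; move: b; apply: pos_root_ind => // b d Md _ pb bd ps pfb.
apply: (@pos_comb 1 (- (2 * B b d)) (f b) (f d)) => //.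
- exact: Phi_act ps.1.
- lra.
- exact: fM.
- by rewrite (refl_simpleE _ (MPi _ Md)) groupD// groupZ// scale1r.
Qed.

(** Extremality of the simple root [f b] rules out a decomposition of [b] into a
    generator and a root of smaller depth. *)
Lemma generator_of_simple_image M f b : M `<=` Pi -> refl_group Pi f ->
  (forall d, M d -> pos (f d)) -> roots_of M b -> pos b -> Pi (f b) -> M b.
Proof.
move=> MPi Wf fM; move: b.
apply: (@pos_root_ind M (fun b => Pi (f b) -> M b)) => //.
move=> b d Md rb pb bd ps _ Pfb.
suff e : d = refl d b by rewrite -e.
apply: (can_inj (ginvK Wf)).
apply: (@simple_extreme _ (f b) (- (2 * B b d))) => //.
- exact: (pos_of_generators MPi Wf fM rb pb).2.
- exact: fM.
- lra.
- by rewrite (refl_simpleE _ (MPi _ Md)) groupD// groupZ.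
Qed.

Lemma roots_of_simple M a : M `<=` Pi -> Pi a -> roots_of M a -> M a.
Proof.
move=> MPi Pa ra; apply: (@generator_of_simple_image M id) => //.
- exact: refl_group_id.
- by move=> d /MPi/pos_simple.
- exact: pos_simple.
Qed.

(** A simple reflection makes no positive root negative except its own. *)
Lemma group_outside J k b : J `<=` Pi -> refl_group J k ->
  pos b -> ~ roots_of J b ->
  pos (k b) /\ ~ roots_of J (k b).
Proof.
move=> JPi Jk pb nb; split; last by move=> /(roots_of_actE JPi Jk).
have [s sJ ->] := refl_groupP JPi Jk; elim: s sJ => [//|a s IH sJ] /=.
have asJ x : x \in s -> J x by move=> xs; apply: sJ; rewrite in_cons xs orbT.
have Ja : J a by apply/sJ/mem_head.
apply: pos_refl => //; [exact: JPi|exact: IH|].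
move=> e; apply: nb; apply: (roots_of_actE JPi (refl_word_group asJ)).
by rewrite e; apply: roots_of_gen.
Qed.

Lemma group_outside_neg J k b : J `<=` Pi -> refl_group J k ->
  pos (- b) -> ~ roots_of J b -> pos (- k b).
Proof.
move=> JPi Jk pb nb; rewrite -(groupN _ (refl_group_sub JPi Jk)).
by have [] := group_outside JPi Jk pb (fun rb => nb (roots_of_oppE JPi rb)).
Qed.

(** The factorization through the minimal representative of a coset of a parabolic
    subgroup is obtained by removing descents in [M] as long as there are any. *)
Lemma coset_split M f : M `<=` Pi -> refl_group Pi f ->
  exists g h, [/\ refl_group M g, refl_group Pi h, f = h \o g &
                  forall d, M d -> pos (h d)].
Proof.
move=> MPi /(refl_groupP (@subset_refl _ Pi))[s].
have [n] := ubnP (size s); elim: n s f => // n IH s f sn sPi ->.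
have Ws := refl_word_group sPi.
have [[d [Md nd]]|nex] := pselect (exists d, M d /\ pos (- refl_word s d)).
  have pd := pos_simple (MPi _ Md).
  have [_ [t [tPi st et]]] := exchange (@subset_refl _ Pi) sPi pd nd.
  have tn : (size t < n)%N by rewrite -ltnS -st.
  have [g [h [Mg Wh e ph]]] := IH t (refl_word t) tn tPi erefl.
  exists (g \o refl d), h; split=> //.
    by apply: refl_group_comp => //; apply: refl_group_refl.
  apply/funext => v /=; rewrite -[v in LHS](refl_invol _ (simple_norm (MPi _ Md))).
  by rewrite [LHS](congr1 (fun f => f _) et) e.
exists id, (refl_word s); split=> //; first exact: refl_group_id.
move=> d Md; apply: contrapT => np; apply: nex; exists d; split=> //.
apply: neg_of_not_pos => //; apply: Phi_act => //.
exact: (pos_simple (MPi _ Md)).1.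
Qed.

(** * Standard parabolic subsystems carried along by a group element *)

Lemma conj_group K f k : K `<=` Pi -> refl_group Pi f -> refl_group K k ->
  exists2 h, refl_group (f @` K) h & forall v, f (k v) = h (f v).
Proof.
move=> KPi Wf /(refl_groupP KPi)[s sK ->].
exists (refl_word (map f s)).
  by apply: refl_word_group => _ /mapP[a /sK Ka ->]; exists a.
by elim: s {sK} => //= a s IH v; rewrite refl_conj// IH.
Qed.

Lemma roots_of_image K f b : K `<=` Pi -> refl_group Pi f ->
  roots_of K b -> roots_of (f @` K) (f b).
Proof.
move=> KPi Wf [k [a [Kk Ka ->]]].
have [h Kh ->] := conj_group KPi Wf Kk.
by exists h, (f a); split=> //; exists a.
Qed.

Lemma image_ginvK K f : refl_group Pi f -> ginv f @` (f @` K) = K.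
Proof.
move=> Wf; rewrite image_comp; apply/seteqP; split=> [_ [a Ka <-]|a Ka].
  by rewrite /= ginvK.
by exists a => //=; rewrite ginvK.
Qed.

Lemma roots_of_preimage K f b : K `<=` Pi -> f @` K `<=` Pi -> refl_group Pi f ->
  roots_of (f @` K) (f b) -> roots_of K b.
Proof.
move=> KPi fKPi Wf /(roots_of_image fKPi (ginv_group Wf)).
by rewrite image_ginvK// ginvK.
Qed.

(** [keeps K f] says that [f^-1] is a morphism onto [K] of the full groupoid; the
    inverses are the convenient representatives because their sign changes occur
    at the roots that form the inversion set. *)
Definition keeps K f := refl_group Pi f /\ f @` K `<=` Pi.

Definition flipped f : set V := [set b | pos b /\ pos (- f b)].

Lemma keeps_id K : K `<=` Pi -> keeps K id.
Proof. by move=> KPi; split; [apply: refl_group_id|rewrite image_id]. Qed.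

Lemma keeps_comp K f g : keeps K f -> keeps (f @` K) g -> keeps K (g \o f).
Proof.
move=> [Wf _] [Wg gPi]; split; first exact: refl_group_comp.
by rewrite -image_comp.
Qed.

Lemma keeps_quot K f g : keeps K f -> keeps K g -> keeps (f @` K) (g \o ginv f).
Proof.
move=> [Wf fPi] [Wg gPi]; split.
  by apply: refl_group_comp => //; apply: ginv_group.
by rewrite -image_comp image_ginvK.
Qed.

Lemma keeps_pos K f a : keeps K f -> K a -> pos (f a).
Proof. by move=> [_ fPi] Ka; apply/pos_simple/fPi; exists a. Qed.

Lemma keeps_pos_roots K f b : K `<=` Pi -> keeps K f ->
  roots_of K b -> pos b -> pos (f b).
Proof.
move=> KPi kf; have [Wf _] := kf; apply: pos_of_generators => // d; exact: keeps_pos kf.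
Qed.

(** The delicate case of the induction is that of a root [b + c d] with [b] in the
    subsystem of [K] and [d] in [D]: its mirror image [d + c b] becomes negative
    because [f] conjugates the group of [K] into a standard one, and it is a
    combination of [b + c d] and [b] with nonnegative coefficients because
    [c >= 1]. *)
Lemma descents_fill K D f b : K `<=` Pi -> D `<=` Pi -> keeps K f ->
  (forall d, D d -> pos (- f d)) -> roots_of (K `|` D) b -> pos b ->
  roots_of K b \/ pos (- f b).
Proof.
move=> KPi DPi kf fD; have [Wf fKPi] := kf.
have MPi : K `|` D `<=` Pi by rewrite subUset.
move: b; apply: pos_root_ind => // [a [Ka|Da]|b d Md rb pb bd ps IH].
- by left; apply: roots_of_gen.
- by right; apply: fD.
have Pd := MPi _ Md; have Wd := refl_group_refl B Pd.
pose c := - (2 * B b d); have c0 : 0 < c by rewrite /c; lra.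
have eb : refl d b = b + c *: d by rewrite refl_simpleE.
have efb : f (refl d b) = f b + c *: f d by rewrite eb groupD// groupZ.
have [rKb|nKb] := pselect (roots_of K (refl d b)); [by left|right].
have [Kd|nKd] := pselect (K d).
  have Kr : refl_group K (refl d) by apply: refl_group_refl.
  have nb : ~ roots_of K b by move=> h; apply: nKb; apply: roots_of_act.
  have {IH} [//|nfb] := IH.
  rewrite refl_conj//; apply: (@group_outside_neg (f @` K)) => //.
    by apply: refl_group_refl; exists d.
  by move=> h; apply: nb; apply: (roots_of_preimage KPi fKPi Wf).
have {Md} Dd : D d by case: Md.
have {IH} [rb'|nfb] := IH; last first.
  apply: (@pos_comb 1 c (- f b) (- f d)) => //; [|exact: ltW|exact: fD|].
  - by apply: (root_opp brs); apply: (Phi_act Wf); exact: ps.1.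
  - by rewrite efb scale1r opprD scalerN.
have ndK : ~ roots_of K d by move/(roots_of_simple KPi Pd).
have bb := pos_form pb.
have Kr := root_refl KPi rb'; have Wr := refl_group_sub KPi Kr.
have er : refl b d = d + c *: b by rewrite reflE// -scaleNr formC.
have erb : refl b b = - b.
  by rewrite reflE// bb mulr1 scaler_nat mulr2n opprD addNKr.
(* For [c < 1] the reflection in [b] maps [b + c d] to the positive root
   [c d - (1 - c * c) b], which contradicts the extremality of [d]. *)
have c1 : 1 <= c.
  rewrite leNgt; apply/negP => clt1.
  have [pr _] := group_outside KPi Kr ps nKb.
  apply: ndK; have <- // : b = d.
  apply: (@simple_extreme d (c^-1 *: refl b (refl d b))
            (c^-1 * (1 - c * c))) => //.
  - by apply: coneZ; [rewrite invr_ge0 ltW|exact: pr.2].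
  - by apply: mulr_gt0; [rewrite invr_gt0|nra].
  - have e1 : refl b (refl d b) + (1 - c * c) *: b = c *: d.
      rewrite eb (groupD _ _ Wr) (groupZ _ _ Wr) erb er scalerDr scalerA.
      by rewrite scalerBl scale1r addrACA addNr add0r addrK.
    by rewrite -scalerA -scalerDr e1 scalerA mulVf ?scale1r// gt_eqF.
have nfr : pos (- f (refl b d)).
  rewrite refl_conj//; apply: (@group_outside_neg (f @` K)) => //.
  - by apply: root_refl => //; apply: roots_of_image.
  - exact: fD.
  - by move=> h; apply: ndK; apply: (roots_of_preimage KPi fKPi Wf).
apply: neg_of_not_pos; first by apply: (Phi_act Wf); exact: ps.1.
move=> pfb; apply: pos_not_neg nfr.
have pfb0 := keeps_pos_roots KPi kf rb' pb.
apply: (@pos_comb c^-1 (c - c^-1) _ _ _ _ _ _ pfb pfb0).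
- by apply: (Phi_act Wf); apply: (Phi_act Wr); apply: (pos_simple Pd).1.
- by rewrite invr_ge0 ltW.
- by rewrite subr_ge0 -[c^-1]mul1r ler_pdivrMr//; nra.
- rewrite er efb (groupD _ _ Wf) (groupZ _ _ Wf) scalerDr scalerA.
  rewrite mulVf ?gt_eqF// scale1r.
  by rewrite scalerBl [_ + f d]addrC -addrA; congr (_ + _); rewrite addrC subrK.
Qed.

(** The bound is the factor [g] of [f] in the group of [K `|` D], split off through a
    minimal coset representative [h].  It keeps [K] simple because [h] maps [g a]
    to the simple root [f a] for [a] in [K]; it inverts the same roots of the
    subsystem of [K `|` D] as [f], since [h] preserves their signs. *)
Lemma lower_bound_of_descents K D f : K `<=` Pi -> D `<=` Pi -> keeps K f ->
  (forall d, D d -> pos (- f d)) ->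
  exists g, [/\ refl_group (K `|` D) g, keeps K g & forall b, pos b ->
    (pos (- g b) <-> roots_of (K `|` D) b /\ ~ roots_of K b)].
Proof.
move=> KPi DPi kf fD; have [Wf fKPi] := kf.
have MPi : K `|` D `<=` Pi by rewrite subUset.
have [g [h [Mg Wh efhg hM]]] := coset_split MPi Wf.
have Wg := refl_group_sub MPi Mg.
have pos_h b : roots_of (K `|` D) b -> pos b -> pos (h b) by exact: pos_of_generators.
have sign b : roots_of (K `|` D) b -> pos b -> pos (- f b) -> pos (- g b).
  move=> rb pb nfb; apply: neg_of_not_pos; first exact: (Phi_act Wg pb.1).
  move=> /(pos_h _ (roots_of_act Mg rb)); move: nfb.
  by rewrite efhg => /[swap]/pos_not_neg.
have kg : keeps K g.
  split=> // _ [a Ka <-].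
  have Ma : (K `|` D) a by left.
  have pa := pos_simple (MPi _ Ma).
  have fa : Pi (h (g a)) by apply: fKPi; exists a; rewrite ?efhg.
  apply/MPi/(generator_of_simple_image MPi Wh hM _ _ fa).
    exact/roots_of_act/roots_of_gen.
  have [//|nga] := root_pos_or (Phi_act Wg pa.1).
  have := pos_h _ (roots_of_opp MPi (roots_of_act Mg (roots_of_gen Ma))) nga.
  by rewrite groupN// => /(pos_not_neg (pos_simple fa)).
exists g; split=> // b pb; split=> [ngb|[rb nb]].
  split; last by move=> /(keeps_pos_roots KPi kg)/(_ pb)/pos_not_neg.
  have [s sM es] := refl_groupP MPi Mg.
  by have [] := @exchange _ s b MPi sM pb; rewrite -es.
by have [] := descents_fill KPi DPi kf fD rb pb => // /(sign _ rb pb).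
Qed.

(** * Inversion sets *)

Lemma flipped_id b : ~ flipped id b.
Proof. by move=> [/pos_not_neg]. Qed.

Lemma flippedN f b : refl_group Pi f -> pos b -> ~ flipped f b -> pos (f b).
Proof.
move=> Wf pb nfb; have [//|nf] := root_pos_or (Phi_act Wf pb.1).
by case: nfb.
Qed.

(** Sign changes of the quotient [x z^-1] of comparable elements come from sign changes
    of [x] which are not sign changes of [z]. *)
Lemma flipped_quot z x b : refl_group Pi z -> refl_group Pi x ->
  flipped z `<=` flipped x -> pos b -> pos (- x (ginv z b)) ->
  flipped x (ginv z b) /\ ~ flipped z (ginv z b).
Proof.
move=> Wz Wx zx pb nx; have Wi := ginv_group Wz.
have nz : ~ flipped z (ginv z b).
  by move=> [_]; rewrite ginvVK// => /(pos_not_neg pb).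
split=> //; split=> //; have [//|ni] := root_pos_or (Phi_act Wi pb.1).
have /zx[_] : flipped z (- ginv z b).
  by split=> //; rewrite groupN// ginvVK// opprK.
by rewrite groupN// => /(pos_not_neg nx).
Qed.

Lemma descent f : refl_group Pi f -> f <> id -> exists2 d, Pi d & flipped f d.
Proof.
move=> Wf fid; have [//|[d Pd nd]] := group_descent (@subset_refl _ Pi) Wf.
by exists d => //; split=> //; apply: pos_simple.
Qed.

(** The quotient of two elements with the same sign changes has no descent. *)
Lemma flipped_inj f g : refl_group Pi f -> refl_group Pi g ->
  flipped f = flipped g -> f = g.
Proof.
move=> Wf Wg e; have Wq : refl_group Pi (f \o ginv g).
  by apply: refl_group_comp => //; apply: ginv_group.
apply: contrapT => fg; have [h|d Pd [pd nd]] := descent Wq.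
  by apply: fg; apply/funext => v; have /= := congr1 (@^~ (g v)) h; rewrite ginvK.
have [] := @flipped_quot g f d Wg Wf => //; first by rewrite e.
by rewrite e.
Qed.

Lemma flipped_finite f : refl_group Pi f -> finite_set (flipped f).
Proof.
move=> /(refl_groupP (@subset_refl _ Pi))[s + ->].
elim/last_ind: s => [_|s d IH sPi].
  by rewrite (_ : flipped _ = set0)//; apply/seteqP; split=> // b /flipped_id.
have Pd : Pi d by apply: sPi; rewrite mem_rcons mem_head.
have {IH}: finite_set (flipped (refl_word s)).
  by apply: IH => a h; apply: sPi; rewrite mem_rcons in_cons h orbT.
move=> /(finite_image (refl d)) fin.
have: finite_set ([set d] `|` refl d @` flipped (refl_word s)).
  by rewrite finite_setU; split=> //; apply: finite_set1.
apply: sub_finite_set => b [pb]; rewrite refl_word_rcons /= => nb.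
have [->|bd] := pselect (b = d); [by left|right].
exists (refl d b); last exact/refl_invol/simple_norm.
by split=> //; apply: pos_refl.
Qed.

Definition height f : nat := #|` fset_set (flipped f)|%fset.

Lemma height_le f g : refl_group Pi g -> flipped f `<=` flipped g ->
  (height f <= height g)%N.
Proof.
move=> /flipped_finite fg s; apply: fsubset_leq_card.
by rewrite -fset_set_sub//; apply: sub_finite_set fg.
Qed.

Lemma height_eq f g : refl_group Pi g -> flipped f `<=` flipped g ->
  (height g <= height f)%N -> flipped f = flipped g.
Proof.
move=> /flipped_finite fg s h; have ff := sub_finite_set s fg.
apply: fset_set_inj; rewrite ?inE//; apply/eqP; rewrite eqEfcard h andbT.
by rewrite -fset_set_sub.
Qed.

Lemma height_lt f g b : refl_group Pi g -> flipped f `<=` flipped g ->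
  flipped g b -> ~ flipped f b -> (height f < height g)%N.
Proof.
move=> Wg s gb fb; rewrite ltnNge; apply/negP => /(height_eq Wg s) e.
by apply: fb; rewrite e.
Qed.

(** Among the elements above [z] having the descents [D] relative to [z] there is a
    least one, as soon as there is any: [z] followed by the bound of
    [lower_bound_of_descents] for the translated object [z K]. *)
Lemma join_above K z x D : K `<=` Pi -> D `<=` Pi -> keeps K z -> keeps K x ->
  flipped z `<=` flipped x -> (forall d, D d -> pos (- x (ginv z d))) ->
  exists j, [/\ keeps K j, flipped z `<=` flipped j,
    forall d, D d -> pos (- j (ginv z d)),
    forall b, flipped j b -> ~ flipped z b -> roots_of (z @` K `|` D) (z b) &
    forall y, keeps K y -> flipped z `<=` flipped y ->
      (forall d, D d -> pos (- y (ginv z d))) -> flipped j `<=` flipped y].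
Proof.
move=> KPi DPi kz kx zx xD; have [Wz zPi] := kz; have [Wx _] := kx.
have kq := keeps_quot kz kx.
have [a [_ ka aE]] := lower_bound_of_descents zPi DPi kq xD.
have [Wa _] := ka.
have aF y : keeps K y -> (forall d, D d -> pos (- y (ginv z d))) ->
    forall b, flipped a b -> pos (- y (ginv z b)).
  move=> ky yD b [pb /(aE _ pb)[rb nb]].
  by have [] := descents_fill zPi DPi (keeps_quot kz ky) yD rb pb.
have split_j b : flipped (a \o z) b -> ~ flipped z b -> flipped a (z b).
  by move=> [pb nb] nz; split=> //; apply: flippedN.
exists (a \o z); split.
- exact: keeps_comp.
- move=> b [pb nzb]; split=> //; apply: contrapT => naz.
  have paz : pos (- - a (z b)).
    apply: neg_of_not_pos naz; apply: (root_opp brs).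
    by apply: (Phi_act Wa); exact: (Phi_act Wz pb.1).
  have fa : flipped a (- z b) by split=> //; rewrite groupN.
  have [] := flipped_quot Wz Wx zx nzb (aF x kx xD _ fa).
  by rewrite groupN ?ginvK//; [move=> [/(pos_not_neg pb)]|apply: ginv_group].
- move=> d Dd; have pd := pos_simple (DPi _ Dd); rewrite /= ginvVK//.
  apply/(aE _ pd); split; first by apply: roots_of_gen; right.
  move=> rd; apply: (pos_not_neg _ (xD _ Dd)).
  exact: (keeps_pos_roots zPi kq rd pd).
- by move=> b /split_j h /h [pzb /(aE _ pzb)[]].
- move=> y ky zy yD b jb; have [/zy//|/(split_j _ jb) ab] := pselect (flipped z b).
  by split; [case: jb|have := aF y ky yD _ ab; rewrite ginvK].
Qed.

(** Of two members of [E] with a common lower bound [z], each is above [z] followed by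
    an atom; the local join of the two atoms closes the diamond, with larger common
    lower bounds.  Hence [E] is directed, and boundedness provides a maximum. *)
Lemma exists_greatest K (E : set (V -> V)) n : K `<=` Pi -> E id ->
  E `<=` keeps K -> (forall x, E x -> height x <= n)%N ->
  (forall x z, E x -> keeps K z -> flipped z `<=` flipped x -> E z) ->
  (forall x y z d e, E x -> E y -> E z -> flipped z `<=` flipped x ->
    flipped z `<=` flipped y -> Pi d -> Pi e -> pos (- x (ginv z d)) ->
    pos (- y (ginv z e)) ->
    exists2 j, E j & [/\ flipped z `<=` flipped j, pos (- j (ginv z d)) &
                         pos (- j (ginv z e))]) ->
  exists2 m, E m & forall x, E x -> flipped x `<=` flipped m.
Proof.
move=> KPi Eid Ekeeps Ebound Edown Elocal.
have up z x d : E z -> E x -> Pi d -> flipped z `<=` flipped x ->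
    pos (- x (ginv z d)) -> exists2 j, E j & [/\ flipped z `<=` flipped j,
      (height z < height j)%N & forall y, E y -> flipped z `<=` flipped y ->
      pos (- y (ginv z d)) -> flipped j `<=` flipped y].
  move=> Ez Ex Pd zx nd; have kz := Ekeeps _ Ez; have kx := Ekeeps _ Ex.
  have dPi : [set d] `<=` Pi by move=> _ ->.
  have [|j [kj zj jd _ jmin]] := join_above KPi dPi kz kx zx; first by move=> _ ->.
  have jx : flipped j `<=` flipped x by apply: jmin => // _ ->.
  exists j; first exact: Edown jx.
  split=> [//||y Ey zy yd]; last by apply: jmin => //; [exact: Ekeeps|move=> _ ->].
  have [fj fz] := flipped_quot kz.1 kj.1 zj (pos_simple Pd) (jd d erefl).
  exact: height_lt kj.1 zj fj fz.
have directed k : forall x y z, (n - height z < k)%N -> E x -> E y -> E z ->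
    flipped z `<=` flipped x -> flipped z `<=` flipped y ->
    exists2 u, E u & flipped x `<=` flipped u /\ flipped y `<=` flipped u.
  elim: k => // k IH x y z zk Ex Ey Ez zx zy.
  have next w : E w -> flipped z `<=` flipped w -> w <> z ->
      exists2 d, Pi d & pos (- w (ginv z d)).
    move=> Ew zw wz; have [Wz _] := Ekeeps _ Ez; have [Ww _] := Ekeeps _ Ew.
    have [|h|d Pd [_ nd]] := @descent (w \o ginv z); last by exists d.
      by apply: refl_group_comp => //; apply: ginv_group.
    apply: wz; apply/funext => v; have /= := congr1 (@^~ (z v)) h.
    by rewrite ginvK.
  have [->|xz] := pselect (x = z).
    by exists y => //; split.
  have [->|yz] := pselect (y = z).
    by exists x => //; split.
  have [d Pd xd] := next x Ex zx xz; have [e Pe ye] := next y Ey zy yz.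
  have [j Ej [zj jd je]] := Elocal x y z d e Ex Ey Ez zx zy Pd Pe xd ye.
  have [zd Ezd [zzd hzd mind]] := up z x d Ez Ex Pd zx xd.
  have [ze Eze [zze hze mine]] := up z y e Ez Ey Pe zy ye.
  have smaller w : (height z < height w)%N -> E w -> (n - height w < k)%N.
    move=> zw Ew; rewrite -ltnS (leq_trans _ zk)// ltnS ltn_sub2l//.
    exact: leq_trans zw (Ebound _ Ew).
  have [u Eu [xu ju]] := IH x j zd (smaller _ hzd Ezd) Ex Ej Ezd
    (mind x Ex zx xd) (mind j Ej zj jd).
  have zeu : flipped ze `<=` flipped u.
    exact: subset_trans (mine j Ej zj je) ju.
  have [t Et [yt ut]] := IH y u ze (smaller _ hze Eze) Ey Eu Eze
    (mine y Ey zy ye) zeu.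
  by exists t => //; split=> //; apply: subset_trans xu ut.
have [m [Em mmax]] : exists m, E m /\ forall x, E x -> (height x <= height m)%N.
  pose hP k := `[< exists2 x, E x & height x = k >].
  have [|k /asboolP[x Ex <-]|k /asboolP[m Em <-] kmax] := @ex_maxnP hP n.
  - by exists (height id); apply/asboolP; exists id.
  - exact: Ebound.
  - by exists m; split=> // x Ex; apply: kmax; apply/asboolP; exists x.
exists m => // x Ex.
have id_le w : flipped id `<=` flipped w by move=> b /flipped_id.
have [u Eu [xu mu]] := directed n.+1 x m id (leq_subr _ _) Ex Em Eid
  (id_le x) (id_le m).
by rewrite (height_eq (Ekeeps _ Eu).1 mu (mmax _ Eu)).
Qed.

(** * Meets and joins *)

(** The least element above [z] having two given descents is a lower bound of [P]
    together with [z], as soon as every member of [P] has these descents. *)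
Lemma exists_meet K (P : set (V -> V)) p0 : K `<=` Pi -> P p0 ->
  P `<=` keeps K ->
  exists2 m, keeps K m & (forall p, P p -> flipped m `<=` flipped p) /\
    forall l, keeps K l -> (forall p, P p -> flipped l `<=` flipped p) ->
      flipped l `<=` flipped m.
Proof.
move=> KPi Pp0 Pk.
pose E := [set z | keeps K z /\ forall p, P p -> flipped z `<=` flipped p].
have [||||x y z d e [kx xP] [ky yP] [kz zP] zx zy Pd Pe xd ye|m [km mP] mmax] :=
    @exists_greatest K E (height p0) KPi.
- by split; [apply: keeps_id|move=> p _ b /flipped_id].
- by move=> z [].
- by move=> z [kz zP]; apply: height_le (zP _ Pp0); exact: (Pk _ Pp0).1.
- by move=> x z [kx xP] kz zx; split=> // p /xP; apply: subset_trans.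
- have dePi : [set d; e] `<=` Pi by move=> _ [->|->].
  have below p t : P p -> [set d; e] t -> pos (- p (ginv z t)).
    move=> Pp [->|->].
    + by have [/(xP _ Pp)[]] := flipped_quot kz.1 kx.1 zx (pos_simple Pd) xd.
    + by have [/(yP _ Pp)[]] := flipped_quot kz.1 ky.1 zy (pos_simple Pe) ye.
  have [|j [kj zj jde _ jmin]] := join_above KPi dePi kz (Pk _ Pp0) (zP _ Pp0).
    by move=> c; apply: below.
  exists j; last by split=> //; apply: jde; [left|right].
  split=> // p Pp; apply: jmin; [exact: Pk|exact: zP|].
  by move=> c; apply: below.
- by exists m => //; split=> // l kl lP; apply: mmax.
Qed.

Definition is_lub K (P : set (V -> V)) j := [/\ keeps K j,
  forall p, P p -> flipped p `<=` flipped j &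
  forall x, keeps K x -> (forall p, P p -> flipped p `<=` flipped x) ->
    flipped j `<=` flipped x].

(** Among the elements below [j] that keep [a] positive there is a greatest one, and it
    bounds [P].  For a local join above [z] could make [a] negative only if [z a]
    belonged to the subsystem of [z K] and the two descents; extremality of [a]
    then makes [z a] one of these generators, so that [a] lies in [K] or is
    already made negative by one of the two elements. *)
Lemma lub_avoids_simple K P j a : K `<=` Pi -> P `<=` keeps K -> is_lub K P j ->
  Pi a -> (forall p, P p -> ~ flipped p a) -> ~ flipped j a.
Proof.
move=> KPi Pk [kj jP jmin] Pa Pa'.
pose E := [set x | [/\ keeps K x, flipped x `<=` flipped j & ~ flipped x a]].
have [||||x y z d e [kx xj xa] [ky yj ya] [kz _ za] zx zy Pd Pe xd ye|
    m [km mj ma] mmax] := @exists_greatest K E (height j) KPi.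
- by split; [apply: keeps_id|move=> b /flipped_id|apply: flipped_id].
- by move=> z [].
- by move=> z [kz zj _]; apply: height_le zj; exact: kj.1.
- move=> x z [kx xj xa] kz zx; split=> //; first exact: subset_trans xj.
  by move=> /zx.
- have dePi : [set d; e] `<=` Pi by move=> _ [->|->].
  have [fx fzx] := flipped_quot kz.1 kx.1 zx (pos_simple Pd) xd.
  have [fy fzy] := flipped_quot kz.1 ky.1 zy (pos_simple Pe) ye.
  have zj := subset_trans zx xj.
  have [|u [ku zu ude urt umin]] := join_above KPi dePi kz kj zj.
    by move=> c [->|->]; [have [] := xj _ fx|have [] := yj _ fy].
  exists u; last by split=> //; apply: ude; [left|right].
  split=> //.
    by apply: umin => // c [->|->]; [have [] := xj _ fx|have [] := yj _ fy].
  move=> ua; have [Wz zPi] := kz.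
  have MPi : z @` K `|` [set d; e] `<=` Pi by rewrite subUset.
  have rza : roots_of (z @` K `|` [set d; e]) (z a) by apply: urt.
  have := generator_of_simple_image MPi (ginv_group Wz) _ rza.
  rewrite ginvK// => -[|||[k Kk /(can_inj (ginvK Wz)) ek]|].
  + move=> c [[k Kk <-]|[->|->]]; [|by case: fx|by case: fy].
    by rewrite ginvK//; apply/pos_simple/KPi.
  + by apply: flippedN => //; apply: pos_simple.
  + exact: Pa.
  + by have := keeps_pos ku Kk; rewrite ek => /pos_not_neg; apply; case: ua.
  + by move=> [e1|e1]; [apply: xa; rewrite -[a](ginvK Wz) e1|
                        apply: ya; rewrite -[a](ginvK Wz) e1].
- have pm p : P p -> flipped p `<=` flipped m.
    by move=> Pp; apply: mmax; split; [exact: Pk|exact: jP|exact: Pa'].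
  by move=> /(jmin m km pm).
Qed.

(** Let [z] be maximal below [q] among the elements whose sign changes are disjoint from
    those of [j].  If [z <> q], then translating by [z] makes [j z^-1] a least upper
    bound of the translates of [P], which all keep a descent of [q z^-1] positive;
    by the simple case so does [j z^-1], and [z] can be enlarged. *)
Lemma lub_avoids K P j q : K `<=` Pi -> P `<=` keeps K -> is_lub K P j ->
  keeps K q -> (forall p b, P p -> flipped p b -> ~ flipped q b) ->
  forall b, flipped j b -> ~ flipped q b.
Proof.
move=> KPi Pk lubj kq Pq; have [kj jP jmin] := lubj.
have [[p0 Pp0]|P0] := pselect (exists p, P p); last first.
  move=> b /(jmin id (keeps_id KPi))[p Pp|]; first by case: P0; exists p.
  by move=> /pos_not_neg.
have [Wj _] := kj; have [Wq _] := kq.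
pose E := [set z | [/\ keeps K z, flipped z `<=` flipped q &
                       forall b, flipped j b -> ~ flipped z b]].
have [z [[kz zq jz] zmax]] :
    exists z, E z /\ forall x, E x -> (height x <= height z)%N.
  pose hP k := `[< exists2 x, E x & height x = k >].
  have [|k /asboolP[x [_ xq _] <-]|k /asboolP[z Ez <-] kmax] :=
    @ex_maxnP hP (height q).
  - exists (height id); apply/asboolP; exists id => //.
    by split; [apply: keeps_id|move=> b /flipped_id|move=> b _ /flipped_id].
  - exact: height_le xq.
  - by exists z; split=> // x Ex; apply: kmax; apply/asboolP; exists x.
suff -> : q = z by [].
apply: contrapT => nqz; have [Wz zPi] := kz; have Wi := ginv_group Wz.
have Wqz : refl_group Pi (q \o ginv z) by apply: refl_group_comp.
have [|h|a Pa [pa na]] := @descent (q \o ginv z) => //.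
  by apply: nqz; apply/funext => v; have /= := congr1 (@^~ (z v)) h; rewrite ginvK.
have aPi : [set a] `<=` Pi by move=> _ ->.
have MPi : z @` K `|` [set a] `<=` Pi by rewrite subUset.
have [|s [ks zs sa srt smin]] := join_above KPi aPi kz kq zq; first by move=> _ ->.
have [sz nz] := flipped_quot Wz ks.1 zs pa (sa a erefl).
suff Es : E s by have := zmax _ Es; rewrite leqNgt (height_lt ks.1 zs sz nz).
split=> //; first by apply: smin => // _ ->.
have [qa _] := flipped_quot Wz Wq zq pa na.
pose P' := [set p \o ginv z | p in P].
have neg_z b : pos b -> pos (- ginv z b) -> flipped z (- ginv z b).
  by move=> pb nb; split=> //; rewrite groupN// ginvVK// opprK.
have quot_neg p b : refl_group Pi p -> (forall b, flipped z b -> ~ flipped p b) ->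
    pos b -> pos (- ginv z b) -> pos (- p (ginv z b)).
  move=> Wp zp pb nb; have fz := neg_z b pb nb.
  by rewrite -groupN//; apply: flippedN => //; apply: zp.
have avoid_z p b : P p -> flipped z b -> ~ flipped p b.
  by move=> Pp /zq qb pb'; apply: (Pq p b).
have lub' : is_lub (z @` K) P' (j \o ginv z).
  split; first exact: keeps_quot.
  - move=> _ [p Pp <-] b [pb nb]; split=> //=.
    have [pib|nib] := root_pos_or (Phi_act Wi pb.1).
      by have [] : flipped j (ginv z b) by apply: jP Pp _ _.
    by apply: quot_neg => // b' zb' jb'; apply: jz jb' zb'.
  - move=> x kx xP'.
    have jx : flipped j `<=` flipped (x \o z).
      apply: jmin; first exact: keeps_comp.
      move=> p Pp b pb; have [pb' nb] := pb; split=> //=.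
      have /(xP' (p \o ginv z))[] // : flipped (p \o ginv z) (z b).
        split; last by rewrite /= ginvK.
        by apply: flippedN => // /(avoid_z _ _ Pp).
      by exists p.
    move=> b [pb /= nb]; split=> //.
    have [pib|nib] := root_pos_or (Phi_act Wi pb.1).
      by have [|_] := jx (ginv z b); [|rewrite /= ginvVK].
    have [] // : flipped x b; apply: (xP' (p0 \o ginv z)); first by exists p0.
    split=> //=; apply: quot_neg => //; first by have [] := Pk _ Pp0.
    by move=> b' zb'; apply: avoid_z.
have P'k : P' `<=` keeps (z @` K).
  by move=> _ [p Pp <-]; apply: keeps_quot => //; apply: Pk.
have na' : ~ flipped (j \o ginv z) a.
  apply: lub_avoids_simple lub' Pa _ => // _ [p Pp <-] [_ npa].
  by apply: (Pq p (ginv z a)) => //; split=> //; case: qa.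
move=> b jb sb; have nzb := jz b jb; have rt_zb := srt b sb nzb.
have pzb : pos (z b) by apply: flippedN => //; case: jb.
have [_] := jb; apply: pos_not_neg; rewrite -(ginvK Wz b).
have [kj' _ _] := lub'; have [Wj' _] := kj'.
apply: (@pos_of_generators _ (j \o ginv z) _ MPi) rt_zb pzb => // d [Kd|->].
  exact: keeps_pos kj' Kd.
by apply: flippedN.
Qed.

(** * Orthogonality and components *)

Notation cox_edge := (cox_edge B).
Notation cox_component := (cox_component B).

Lemma proportional_pos b d c : pos b -> pos d -> b = c *: d -> b = d.
Proof.
move=> pb pd e; have bb := pos_form pb; have dd := pos_form pd.
have /eqP : c ^+ 2 = 1 by rewrite -bb e formZl formZr dd mulr1.
rewrite sqrf_eq1 => /orP[/eqP c1|/eqP c1]; first by rewrite e c1 scale1r.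
by case: (pos_not_neg pd); rewrite -scaleN1r -c1 -e.
Qed.

Lemma refl_perp x y : B y x = 0 -> refl x y = y.
Proof. by move=> e; rewrite /Defs.refl e mulr0 mul0r scale0r subr0. Qed.

Lemma edge_form_neq0 x y : Pi x -> Pi y -> cox_edge x y -> B x y <> 0.
Proof.
move=> Px Py [_ /(_ 2%N erefl) h] xy0; apply: h; apply/funext => v.
have yx : refl x y = y by apply: refl_perp; rewrite formC.
have com w : refl x (refl y w) = refl y (refl x w).
  by rewrite (refl_conj _ _ (refl_group_refl B Px)) yx.
change (refl x (refl y (refl x (refl y v))) = v).
rewrite (com v) (refl_invol _ (simple_norm Py)).
by rewrite (refl_invol _ (simple_norm Px)).
Qed.

(** If the product of two reflections has order at most two, then the reflection in
    [refl y x] equals that in [x], which forces [refl y x = x]. *)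
Lemma nonedge_form_eq0 x y : Pi x -> Pi y -> x <> y -> ~ cox_edge x y -> B x y = 0.
Proof.
move=> Px Py xy nexy.
have h v : refl x (refl y (refl x (refl y v))) = v.
  apply: contrapT => hv; apply: nexy; split=> // -[//|[|[|//]]] _ e.
  - have e1 w : refl x (refl y w) = w := congr1 (fun f => f w) e.
    by apply: hv; rewrite !e1.
  - by apply: hv; exact: (congr1 (fun f => f v) e).
have Wy := refl_group_refl B Py; have Wx := refl_group_refl B Px.
have [xx yy] := (simple_norm Px, simple_norm Py).
have pyx : pos (refl y x) by apply: pos_refl => //; apply: pos_simple.
have e : refl (refl y x) x = - x.
  have -> v : refl (refl y x) v = refl x v.
    rewrite -[in LHS](refl_invol v yy) -(refl_conj _ _ Wy).
    by rewrite -[LHS](refl_invol _ xx) h.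
  exact: (refl_self brs Px).
have e2 : (2 * B x (refl y x)) *: refl y x = x + x.
  have double (u w : V) : u - w = - u -> w = u + u.
    by move=> h'; rewrite -[X in _ = u + X]opprK -h' opprB addrC subrK.
  by apply: double; rewrite -reflE// (pos_form pyx).
have exy : x = refl y x.
  apply: (@proportional_pos _ _ (B x (refl y x))) => //; first exact: pos_simple.
  have -> : B x (refl y x) = 2^-1 * (2 * B x (refl y x)).
    by rewrite mulrA mulVf ?mul1r ?pnatr_eq0.
  rewrite -scalerA e2 -mulr2n -scaler_nat scalerA mulVf ?pnatr_eq0//.
  by rewrite scale1r.
have /eqP : (2 * B x y) *: y = 0.
  have e3 : x - (2 * B x y) *: y = x by rewrite -reflE// -exy.
  by apply: (addrI (x - (2 * B x y) *: y)); rewrite subrK addr0 e3.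
rewrite scaler_eq0 mulf_eq0 pnatr_eq0/= => /orP[/eqP//|/eqP y0].
by case: (root_neq0 brs (pos_simple Py).1).
Qed.

Lemma roots_of_perp M v : M `<=` Pi -> (forall x, M x -> B x v = 0) ->
  forall u, roots_of M u -> B u v = 0.
Proof.
move=> MPi Mv _ [w [a [Mw Ma ->]]]; have [s sM ->] := refl_groupP MPi Mw.
elim: s sM => [|d s IH] sM /=; first exact: Mv.
have Md : M d by apply/sM/mem_head.
rewrite refl_simpleE; last exact: MPi.
rewrite formDl formZl (Mv d Md) mulr0 addr0.
by apply: IH => x xs; apply: sM; rewrite in_cons xs orbT.
Qed.

Lemma roots_of_perp2 L C u v : L `<=` Pi -> C `<=` Pi ->
  (forall x y, L x -> C y -> B x y = 0) -> roots_of L u -> roots_of C v ->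
  B u v = 0.
Proof.
move=> LPi CPi LC ru rv; apply: (roots_of_perp LPi) ru => x Lx.
by rewrite formC; apply: (roots_of_perp CPi) rv => y Cy; rewrite formC; apply: LC.
Qed.

Lemma roots_of_disjoint L C b : L `<=` Pi -> C `<=` Pi ->
  (forall x y, L x -> C y -> B x y = 0) -> roots_of L b -> ~ roots_of C b.
Proof.
move=> LPi CPi LC rL rC; have /eqP := roots_of_perp2 LPi CPi LC rL rC.
by rewrite (root_form LPi rL) oner_eq0.
Qed.

(** Generators of one part cannot be added to roots of the other, to which they are
    orthogonal. *)
Lemma roots_of_split L C b : L `<=` Pi -> C `<=` Pi ->
  (forall x y, L x -> C y -> B x y = 0) -> roots_of (L `|` C) b -> pos b ->
  roots_of L b \/ roots_of C b.
Proof.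
move=> LPi CPi LC; have MPi : L `|` C `<=` Pi by rewrite subUset.
move: b; apply: pos_root_ind => // [x [Lx|Cx]|b d [Ld|Cd] _ _ bd0 _ [rb|rb]].
- by left; apply: roots_of_gen.
- by right; apply: roots_of_gen.
- by left; apply: roots_of_act => //; apply: refl_group_refl.
- have bd := roots_of_perp2 LPi CPi LC (roots_of_gen Ld) rb.
  by move: bd0; rewrite formC bd ltxx.
- by move: bd0; rewrite (roots_of_perp2 LPi CPi LC rb (roots_of_gen Cd)) ltxx.
- by right; apply: roots_of_act => //; apply: refl_group_refl.
Qed.

Lemma component_ind M a (Q : V -> Prop) : Q a ->
  (forall x y, M x -> M y -> cox_edge x y -> Q x -> Q y) ->
  cox_component M a `<=` Q.
Proof.
move=> Qa Qe b Lb; move: Qa.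
by elim: Lb => [x y [Mx My xy]|//|x y z _ xy _ yz /xy//]; apply: Qe.
Qed.

Lemma component_self M a : cox_component M a a.
Proof. exact: rt_refl. Qed.

Lemma component_sub M a : M a -> cox_component M a `<=` M.
Proof. by move=> Ma; apply: component_ind. Qed.

Lemma component_perp M a x y : M `<=` Pi -> M a -> cox_component M a x ->
  (M `\` cox_component M a) y -> B x y = 0.
Proof.
move=> MPi Ma Lx [My Ly]; have Mx := component_sub Ma Lx.
apply: nonedge_form_eq0; [exact: MPi|exact: MPi|by move=> e; apply: Ly; rewrite -e|].
by move=> xy; apply: Ly; apply: rt_trans Lx _; apply: rt_step.
Qed.

(** A parabolic subgroup with finitely many roots is finite because its elements are
    determined by the roots whose sign they change. *)
Lemma finite_typeP L : L `<=` Pi ->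
  finite_set [set b | pos b /\ roots_of L b] -> finite_type B L.
Proof.
move=> LPi; set F := [set b | _] => finF.
have FE f : refl_group L f -> flipped f `<=` F.
  move=> Lf b [pb nb]; split=> //; have [s sL es] := refl_groupP LPi Lf.
  by have [] := @exchange L s b LPi sL pb; rewrite -?es.
pose elt (S : set V) :=
  xget (id : V -> V) [set f | refl_group L f /\ flipped f = S].
have: finite_set (elt @` [set S | S `<=` F]).
  apply: finite_image.
  have: finite_set
      ((fun X : {fset V} => [set` X]) @` [set` fpowerset (fset_set F)]).
    by apply: finite_image; apply: finite_fset.
  apply: sub_finite_set => S SF; have fS := sub_finite_set SF finF.
  exists (fset_set S); last exact: fset_setK.
  by rewrite /= fpowersetE -fset_set_sub.
apply: sub_finite_set => f Lf; exists (flipped f); first exact: FE.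
apply: xget_unique => // g [Lg]; apply: flipped_inj; exact: refl_group_sub LPi _ _.
Qed.

(** * Longest elements *)

Lemma cox_length_exists L f : L `<=` Pi -> refl_group L f ->
  exists n, cox_length B L f n.
Proof.
move=> LPi Lf; have [s0 s0L e0] := refl_groupP LPi Lf.
pose hP k := `[< exists s, [/\ forall a, a \in s -> L a, f = refl_word s &
                              size s = k] >].
have [|k /asboolP Hk kmin] := @ex_minnP hP.
  by exists (size s0); apply/asboolP; exists s0.
exists k; split=> // s sL es; apply: kmin; apply/asboolP; by exists s.
Qed.

Lemma longest_exists L : L `<=` Pi -> finite_type B L ->
  exists f, is_longest B L f.
Proof.
move=> LPi /finite_seqP[s es].
have sE f : refl_group L f -> f \in s.
  by move=> Lf; have : [set w | refl_group L w] f by []; rewrite es.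
pose l f := xget 0%N (cox_length B L f).
have lP f : refl_group L f -> cox_length B L f (l f).
  by move=> Lf; apply: xgetPex; apply: cox_length_exists.
have l_unique f n : cox_length B L f n -> refl_group L f -> n = l f.
  move=> [[t [tL et <-]] nmin] /lP[[u [uL eu <-]] lmin].
  by apply/eqP; rewrite eqn_leq nmin// lmin.
pose hP k := `[< exists2 f, refl_group L f & l f = k >].
have [||k /asboolP[f Lf <-] kmax] := @ex_maxnP hP (\max_(f <- s) l f).
- by exists (l id); apply/asboolP; exists id => //; apply: refl_group_id.
- by move=> k /asboolP[f Lf <-]; apply: leq_bigmax_seq => //; apply: sE.
exists f; split=> //; exists (l f); first exact: lP.
move=> g m Lg /l_unique-/(_ Lg) ->; apply: kmax; apply/asboolP; by exists g.
Qed.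

(** If the longest element [w] kept a generator [d] positive, then deleting a letter
    from a shortest word of [w s_d], which is no longer than [w], would yield a word for
    [w] that is too short. *)
Lemma longest_spec L : L `<=` Pi -> finite_type B L ->
  refl_group L (longest B L) /\
  forall b, roots_of L b -> pos b -> pos (- longest B L b).
Proof.
move=> LPi /(longest_exists LPi)/(xgetPex (id : V -> V)).
rewrite -/(longest B L); set w := longest B L.
move=> -[Lw [n [[s [sL es sn]] nmin] nmax]].
split=> //; have Ww := refl_group_sub LPi Lw.
have gens d : L d -> pos (- w d).
  move=> Ld; have Pd := LPi _ Ld; have pd := pos_simple Pd.
  apply: neg_of_not_pos; first exact: (Phi_act Ww pd.1).
  move=> pwd; have Ld' := refl_group_refl B Ld.
  have Lwd := refl_group_comp Lw Ld'.
  have [m wm] := cox_length_exists LPi Lwd; have mn := nmax _ _ Lwd wm.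
  have [[t [tL et tm]] _] := wm.
  have ntd : pos (- refl_word t d).
    by rewrite -et /= (refl_self brs Pd) groupN// opprK.
  have [_ [u [uL tu eu]]] := exchange LPi tL pd ntd.
  have /(nmin u uL) : w = refl_word u.
    by rewrite -eu -et; apply/funext => v /=; rewrite refl_invol// simple_norm.
  by rewrite leqNgt; apply/negP; rewrite negbK -ltnS -tu tm ltnS.
apply: pos_root_ind => // b d Ld _ _ bd ps pwb.
apply: (@pos_comb 1 (- (2 * B b d)) (- w b) (- w d)) => //.
- by apply: (root_opp brs); apply: (Phi_act Ww); exact: ps.1.
- lra.
- exact: gens.
- by rewrite (refl_simpleE _ (LPi _ Ld)) groupD// groupZ// scale1r opprD scalerN.
Qed.

(** * The component of a simple root adjoined to an object *)

Section ComponentOfNewRoot.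
Variables (J : set V) (a : V).
Hypotheses (JPi : J `<=` Pi) (Pa : Pi a) (Ja : ~ J a).

Let M := J `|` [set a].
Let L := cox_component M a.

Let MPi : M `<=` Pi.
Proof. by rewrite subUset; split=> // _ ->. Qed.

Let Ma : M a. Proof. by right. Qed.

Let LM : L `<=` M. Proof. exact: component_sub. Qed.

Let LPi : L `<=` Pi. Proof. exact: subset_trans LM MPi. Qed.

Let IJ : L `&` J `<=` J. Proof. by move=> x []. Qed.

Let IPi : L `&` J `<=` Pi. Proof. exact: subset_trans IJ JPi. Qed.

Let IL : L `&` J `<=` L. Proof. by move=> x []. Qed.

Let CJ : M `\` L `<=` J.
Proof. by move=> x [[//|->] []]; apply: component_self. Qed.

Let CPi : M `\` L `<=` Pi. Proof. exact: subset_trans CJ JPi. Qed.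

Let LC x y : L x -> (M `\` L) y -> B x y = 0.
Proof. exact: component_perp. Qed.

(** The rest of [M] is orthogonal to the component and contained in [J]. *)
Lemma new_roots b : pos b ->
  (roots_of M b /\ ~ roots_of J b) <-> (roots_of L b /\ ~ roots_of (L `&` J) b).
Proof.
move=> pb; split=> -[rb nb].
  have : roots_of (L `|` (M `\` L)) b by rewrite setDUK.
  move=> /(roots_of_split LPi CPi LC)/(_ pb)[rLb|/(roots_of_sub CJ)//].
  by split=> // /(roots_of_sub IJ).
split; first exact: roots_of_sub LM _ rb.
move=> rJ; apply: nb.
have eJ : J = (L `&` J) `|` (M `\` L).
  apply/seteqP; split=> [x Jx|x [[]//|/CJ//]].
  by have [Lx|Lx] := pselect (L x); [left|right; split=> //; left].
have LC' x y : (L `&` J) x -> (M `\` L) y -> B x y = 0.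
  by move=> [Lx _]; apply: LC.
have : roots_of ((L `&` J) `|` (M `\` L)) b by rewrite -eJ.
move=> /(roots_of_split IPi CPi LC')/(_ pb)[//|rC].
by case: (roots_of_disjoint LPi CPi LC rb rC).
Qed.

(** The group of [J] permutes the new positive roots, so that orthogonality to all
    of them propagates along the edges of the component. *)
Lemma perp_new_roots v x :
  (forall b, pos b -> roots_of M b -> ~ roots_of J b -> B b v = 0) ->
  L x -> B x v = 0.
Proof.
pose Q y := forall v,
  (forall b, pos b -> roots_of M b -> ~ roots_of J b -> B b v = 0) -> B y v = 0.
suff LQ : L `<=` Q by move=> Fv /LQ; apply.
move=> {v x}; apply: component_ind => [|x y Mx My xy IH] v Fv.
  apply: Fv; [exact: pos_simple|exact: roots_of_gen|].
  by move=> /(roots_of_simple JPi Pa).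
have Py := MPi My; have yy := simple_norm Py.
case: (My) => [Jy|->]; last first.
  apply: Fv; [exact: pos_simple|exact: roots_of_gen|].
  by move=> /(roots_of_simple JPi Pa).
have Jr : refl_group J (refl y) by apply: refl_group_refl.
have : B x (refl y v) = 0.
  apply: IH => b pb rb nb; rewrite -(refl_form _ _ yy) (refl_invol _ yy).
  have [pyb nyb] := group_outside JPi Jr pb nb.
  by apply: Fv => //; apply: roots_of_act => //; apply: refl_group_refl.
rewrite refl_simpleE// formDr formZr IH// add0r => /eqP.
rewrite mulf_eq0 oppr_eq0 mulf_eq0 pnatr_eq0/= => /orP[/eqP|/eqP].
  by rewrite formC.
by move/(edge_form_neq0 (MPi Mx) Py xy).
Qed.

(** A root of [J] in the component is not orthogonal to all new roots; its reflection
    moves one of them to another one, and the root is proportional to their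
    difference. *)
Lemma component_roots_finite :
  finite_set [set b | [/\ pos b, roots_of M b & ~ roots_of J b]] ->
  finite_set [set b | pos b /\ roots_of L b].
Proof.
set F := [set b | _] => finF.
pose diff (p : V * V) := xget (0 : V)
  [set v | pos v /\ exists2 c, c <> 0 & p.2 - p.1 = c *: v].
have: finite_set (F `|` diff @` (F `*` F)).
  rewrite finite_setU; split=> //; apply: finite_image; exact: finite_setX.
apply: sub_finite_set => b [pb rLb].
have [rJb|nJb] := pselect (roots_of J b); last first.
  by left; split=> //; apply: roots_of_sub LM _ rLb.
right; have [[u [Fu ub]]|h] := pselect (exists u, F u /\ B u b <> 0); last first.
  have Fb u : pos u -> roots_of M u -> ~ roots_of J u -> B u b = 0.
    by move=> *; apply: contrapT => ub; apply: h; exists u.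
  have /eqP := roots_of_perp LPi (fun x => @perp_new_roots b x Fb) rLb.
  by rewrite (pos_form pb) oner_eq0.
have [pu ru nu] := Fu; have Jr := root_refl JPi rJb.
have [pu' nu'] := group_outside JPi Jr pu nu.
exists (u, refl b u).
  split=> //; split=> //=; apply: roots_of_act ru.
  by apply: root_refl => //; apply: roots_of_sub LM _ rLb.
have eb : refl b u - u = (- (2 * B u b)) *: b.
  by rewrite reflE ?(pos_form pb)// addrAC subrr add0r scaleNr.
have c0 : - (2 * B u b) <> 0.
  by apply/eqP; rewrite oppr_eq0 mulf_eq0 pnatr_eq0/=; apply/eqP.
apply: xget_unique => [|v [pv [c cn0]]].
  by split=> //; exists (- (2 * B u b)).
rewrite /= eb => ecg; apply: (@proportional_pos _ _ (c^-1 * - (2 * B u b))) => //.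
by rewrite -scalerA ecg scalerA mulVf ?scale1r//; apply/eqP.
Qed.

Lemma nu_group : finite_type B L -> refl_group L (nu B a J).
Proof.
move=> finL; have finI : finite_type B (L `&` J).
  by apply: sub_finite_set finL => f; apply: refl_group_sub.
have [LL _] := longest_spec LPi finL; have [II _] := longest_spec IPi finI.
by apply: refl_group_comp => //; apply: refl_group_sub II.
Qed.

(** The longest element of [L `&` J] permutes the positive roots of [L] outside
    [L `&` J], and that of [L] then makes them negative, while the roots of
    [L `&` J] change sign twice. *)
Lemma flipped_nu : finite_type B L ->
  flipped (nu B a J) = [set b | pos b /\ (roots_of M b /\ ~ roots_of J b)].
Proof.
move=> finL; have finI : finite_type B (L `&` J).
  by apply: sub_finite_set finL => f; apply: refl_group_sub.
have [LL negL] := longest_spec LPi finL; have [II negI] := longest_spec IPi finI.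
have WL := refl_group_sub LPi LL; have WI := refl_group_sub IPi II.
have IL' := refl_group_sub IL II.
apply/seteqP; split=> b [pb].
  move=> nb; split=> //; apply/(new_roots pb); split.
    apply: contrapT => nLb.
    have nIb : ~ roots_of (L `&` J) b by move=> /(roots_of_sub IL).
    have [pIb _] := group_outside IPi II pb nIb.
    have nLIb : ~ roots_of L (longest B (L `&` J) b).
      by move=> /(roots_of_actE LPi IL').
    have [pLb _] := group_outside LPi LL pIb nLIb.
    exact: pos_not_neg pLb nb.
  move=> rIb; have nIb := negI b rIb pb.
  have rL : roots_of L (- longest B (L `&` J) b).
    apply: roots_of_opp => //; apply: roots_of_act => //.
    exact: roots_of_sub IL _ rIb.
  have := negL _ rL nIb.
  by rewrite groupN// opprK => /pos_not_neg; apply.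
move=> /(new_roots pb)[rLb nIb]; split=> //.
have [pIb _] := group_outside IPi II pb nIb.
by apply: negL => //; apply: roots_of_act.
Qed.

Lemma nu_simple x : finite_type B L -> J x -> Pi (nu B a J x) -> M (nu B a J x).
Proof.
move=> /nu_group Ln Jx Pn; apply: (roots_of_simple MPi) => //.
by apply: roots_of_act; [apply: refl_group_sub LM _ Ln|apply: roots_of_gen; left].
Qed.

End ComponentOfNewRoot.

(** * Elementary maps *)

(** These turn out to be the atoms. *)
Definition elementary K a g := [/\ Pi a, ~ K a, keeps K g &
  flipped g = [set b | pos b /\ (roots_of (K `|` [set a]) b /\ ~ roots_of K b)]].

Section Elementary.
Variable K : set V.
Hypothesis KPi : K `<=` Pi.

Lemma elementary_flipped a g : elementary K a g -> flipped g a.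
Proof.
move=> [Pa nKa _ ->]; split; first exact: pos_simple.
by split; [apply: roots_of_gen; right|move=> /(roots_of_simple KPi Pa)].
Qed.

Lemma elementary_below f a : keeps K f -> Pi a -> flipped f a ->
  exists g, elementary K a g.
Proof.
move=> kf Pa [pa na].
have aPi : [set a] `<=` Pi by move=> _ ->.
have [|g [_ kg gE]] := lower_bound_of_descents KPi aPi kf; first by move=> _ ->.
exists g; split=> //; first by move=> /(keeps_pos kf)/pos_not_neg.
apply/seteqP; split=> b [pb]; first by move=> /(gE b pb).
by move=> h; split=> //; apply/(gE b pb).
Qed.

Lemma elementary_le a g f : elementary K a g -> keeps K f -> flipped f a ->
  flipped g `<=` flipped f.
Proof.
move=> [Pa nKa _ ->] kf [_ na] b [pb [rb nb]]; split=> //.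
have aPi : [set a] `<=` Pi by move=> _ ->.
have aD d : [set a] d -> pos (- f d) by move=> ->.
by have [/nb|//] := descents_fill KPi aPi kf aD rb pb.
Qed.

Lemma elementary_disjoint a g f b : elementary K a g -> keeps K f ->
  ~ flipped f a -> flipped g b -> ~ flipped f b.
Proof.
move=> [Pa nKa _ ->] kf na [pb [rb _]] [_]; have [Wf _] := kf.
have MPi : K `|` [set a] `<=` Pi by rewrite subUset; split=> // _ ->.
apply: pos_not_neg; apply: (pos_of_generators MPi Wf) rb pb => d [Kd|->].
  exact: keeps_pos kf Kd.
by apply: flippedN => //; apply: pos_simple.
Qed.

Lemma elementary_minimal a g h : elementary K a g -> keeps K h -> h <> id ->
  flipped h `<=` flipped g -> flipped h = flipped g.
Proof.
move=> eg kh hid hg; apply/seteqP; split=> //.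
have [Wh _] := kh; have [d Pd hd] := descent Wh hid.
apply: (elementary_le eg) => //; suff <- : d = a by [].
have [Pa _ _ gE] := eg; have := hg _ hd; rewrite gE => -[_ [rd nd]].
have MPi : K `|` [set a] `<=` Pi by rewrite subUset; split=> // _ ->.
by have [/(@roots_of_gen K)|] := roots_of_simple MPi Pd rd.
Qed.

(** Finiteness of inversion sets is what forces finite type. *)
Lemma elementary_nuP a g : elementary K a g <->
  [/\ Pi a, ~ K a, keeps K g, finite_type B (cox_component (K `|` [set a]) a) &
      g = nu B a K].
Proof.
split=> [[Pa nKa kg gE]|[Pa nKa kg fin eg]]; last first.
  by split=> //; rewrite eg flipped_nu.
have MPi : K `|` [set a] `<=` Pi by rewrite subUset; split=> // _ ->.
have LPi : cox_component (K `|` [set a]) a `<=` Pi.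
  by apply: subset_trans MPi; apply: component_sub; right.
have fin : finite_type B (cox_component (K `|` [set a]) a).
  apply: finite_typeP => //; apply: component_roots_finite => //.
  by apply: sub_finite_set (flipped_finite kg.1) => b []; rewrite gE.
split=> //; apply: flipped_inj; first exact: kg.1.
  by apply: refl_group_sub LPi _ _; apply: nu_group.
by rewrite gE flipped_nu.
Qed.

End Elementary.

End Roots.

(** * Brink-Howlett groupoids *)

Section BrinkHowlett.
Variables (R : realType) (V : lmodType R) (B : {symmetric V}).
Variables (Phi Pi : set V) (brs : based_root_system B Phi Pi).
Variables (O : set (full_bh_groupoid brs)) (hO : union_of_components O).

Notation G := (bh_groupoid O).
Notation X := (root_gset O).
Notation keeps := (keeps B Pi).
Notation flipped := (flipped Phi Pi).
Notation elementary := (elementary B Phi Pi).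

Implicit Types (J K : G) (f g h : V -> V) (a b : V).

Definition under K : set V := bh_set (sval K).

Lemma under_sub K : under K `<=` Pi.
Proof. exact: bh_sub. Qed.

(** The inverse of the underlying group element, as its sign changes are the
    inversions. *)
Definition codom_map K (g : into K) : V -> V := bh_invfun brs (projT2 g).

Lemma codom_map_keeps K (g : into K) : keeps (under K) (codom_map g).
Proof.
split; first exact: bh_inv_group.
by rewrite bh_inv_image; exact: bh_sub.
Qed.

Lemma into_inversionsE K (g : into K) (x : X K) :
  into_inversions g x <-> flipped (codom_map g) (sval x).
Proof.
have pos_root (y : X K) : spos y <-> pos Phi Pi (sval y).
  by split=> [cy|[]//]; split=> //; apply: svalP.
rewrite /into_inversions inversionsE; split=> [[/pos_root px nx]|[px nx]].
  by split=> //; apply/(pos_root (sopp (act (minv (projT2 g)) x)))/spos_opp.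
split; first exact/pos_root.
by apply/(spos_opp (act (minv (projT2 g)) x))/(pos_root (sopp _)).
Qed.

Lemma wleE K (g h : into K) :
  wle X g h <-> flipped (codom_map g) `<=` flipped (codom_map h).
Proof.
split=> gh; last by move=> x /into_inversionsE/gh/into_inversionsE.
move=> b gb; have [[Pb _] _] := gb.
by apply/(into_inversionsE h (exist _ b Pb))/gh/into_inversionsE.
Qed.

Lemma disjointE K (g h : into K) :
  @into_inversions _ X K g `&` into_inversions h = set0 <->
  forall b, flipped (codom_map g) b -> ~ flipped (codom_map h) b.
Proof.
split=> [e b gb hb|dis]; last first.
  by apply/seteqP; split=> // x [/into_inversionsE/dis nh /into_inversionsE].
have [[Pb _] _] := gb.
suff : (set0 : set (X K)) (exist _ b Pb) by [].
by rewrite -e; split; apply/into_inversionsE.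
Qed.

Lemma codom_map_inj K (g h : into K) : codom_map g = codom_map h -> g = h.
Proof.
case: g h => [J v] [L w] e.
have ef : bh_fun v = bh_fun w.
  apply/funext => x; rewrite -[LHS](bh_invfunK brs w).
  by have := congr1 (@^~ (bh_fun v x)) e; rewrite /codom_map /= bh_funK => <-.
have eJ : J = L.
  apply: eq_sig_hprop => [? ? ?|]; first exact: Prop_irrelevance.
  have : bh_set (sval J) = bh_set (sval L).
    rewrite -(bh_inv_image brs v) -(bh_inv_image brs w).
    exact: (congr1 (fun f : V -> V => f @` under K) e).
  move: (sval J) (sval L) => [S SPi] [T TPi] /= eST; case: _ / eST in TPi *.
  by congr BhOb; apply: Prop_irrelevance.
case: _ / eJ in w e ef *; congr existT.
exact: bh_hom_inj.
Qed.

(** The source [f K] is an object because the objects form a union of components. *)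
Lemma codom_map_surj K f : keeps (under K) f -> exists g : into K, codom_map g = f.
Proof.
move=> [Wf fPi].
have fi : ginv f @` bh_set (BhOb fPi) = bh_set (sval K).
  exact: (image_ginvK brs).
pose m := BhHom (ginv_group brs Wf) fi.
have OJ : O (BhOb fPi).
  have [A eO] := hO; have := svalP K; rewrite {1}eO => -[a Aa [q]].
  by rewrite eO; exists a => //; constructor; exact: (bh_comp (bh_inv brs m) q).
exists (existT (fun J : G => mor J K) (exist O (BhOb fPi) OJ) m).
apply/funext => x; rewrite /codom_map /=.
rewrite -[x in LHS](ginvK brs Wf); exact: (bh_funK brs m).
Qed.

Lemma codom_map_idm K : codom_map (to_into (idm K)) = id.
Proof. by apply/funext => x; exact: (bh_funK brs (bh_id B (sval K)) x). Qed.

Lemma codom_map_minv J K (w : mor J K) :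
  codom_map (to_into (minv w)) = bh_fun w.
Proof.
apply/funext => x; rewrite -[x in LHS](bh_funK brs w).
exact: (bh_funK brs (bh_inv brs w)).
Qed.

Lemma codom_map_id K (g : into K) : codom_map g = id -> g = to_into (idm K).
Proof. by move=> e; apply: codom_map_inj; rewrite codom_map_idm. Qed.

Lemma gset_faithful : faithful X.
Proof.
move=> K g h e; apply: codom_map_inj.
have [[Wg _] [Wh _]] := (codom_map_keeps g, codom_map_keeps h).
by apply: (flipped_inj brs Wg Wh); apply/seteqP; split; apply/wleE; rewrite /wle e.
Qed.

Lemma atomic_elementary J K (w : mor J K) :
  atomic X w <-> exists a, elementary (under K) a (codom_map (to_into w)).
Proof.
have KPi := @under_sub K; have kw := codom_map_keeps (to_into w).
split=> [[w1 wmin]|[a ew]].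
  have [a Pa wa] : exists2 a, Pi a & flipped (codom_map (to_into w)) a.
    by apply: (descent brs kw.1) => /codom_map_id.
  have [f ef] := elementary_below brs KPi kw Pa wa.
  have [_ _ kf _] := ef; have [g eg] := codom_map_surj kf.
  have gw : wle X g (to_into w).
    by apply/wleE; rewrite eg; apply: (elementary_le brs KPi ef).
  have [g1|<-] := wmin g gw; last by exists a; rewrite eg.
  have := elementary_flipped brs KPi ef.
  by rewrite -eg g1 codom_map_idm => /(flipped_id brs).
split=> [w1|g /wleE gw].
  have := elementary_flipped brs KPi ew.
  by rewrite w1 codom_map_idm => /(flipped_id brs).
have kg := codom_map_keeps g.
have [/codom_map_id|g1] := pselect (codom_map g = id); [by left|right].
have e := elementary_minimal brs KPi ew kg g1 gw.
exact/codom_map_inj/(flipped_inj brs kg.1 kw.1 e).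
Qed.

Lemma gset_preprincipal : preprincipal X.
Proof.
split; first exact: gset_faithful.
  move=> J K w.
  have fin (L M : G) (v : mor M L) : finite_set (@inversions _ X _ _ v).
    have finv := flipped_finite brs (codom_map_keeps (to_into v)).1.
    have: finite_set
        ((fun x : X L => sval x) @^-1` flipped (codom_map (to_into v))).
      by apply: finite_preimage finv => x y _ _; apply: root_inj.
    by apply: sub_finite_set => x /(into_inversionsE (to_into v)).
  have [n wn] := (finite_set_leP _).1 (fin _ _ w).
  by have [m _ wm] := atomic_word gset_faithful fin wn; exists m.
move=> K J L g s /atomic_elementary[a es].
have KPi := @under_sub K; have kg := codom_map_keeps (to_into g).
have [ga|nga] := pselect (flipped (codom_map (to_into g)) a).
  by left; apply/(wleE (to_into s) (to_into g)); apply: (elementary_le brs KPi es).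
right; apply/(disjointE (to_into s) (to_into g)) => b.
exact: (elementary_disjoint brs KPi es kg nga).
Qed.

Lemma gset_rootoidal : rootoidal X.
Proof.
split=> [|K]; first exact: gset_faithful.
have KPi := @under_sub K.
split=> [P [p0 Pp0]|P q j Pq [jP jmin]].
  pose P' := [set codom_map p | p in P].
  have P'k : P' `<=` keeps (under K) by move=> _ [p _ <-]; apply: codom_map_keeps.
  have [|f kf [fP fmax]] := exists_meet brs KPi (p0 := codom_map p0) _ P'k.
    by exists p0.
  have [m em] := codom_map_surj kf.
  exists m; split=> [p Pp|l lP]; apply/wleE; rewrite em.
    by apply: fP; exists p.
  apply: fmax; first exact: codom_map_keeps.
  by move=> _ [p Pp <-]; apply/wleE/lP.
apply/disjointE => b.
apply: (@lub_avoids _ _ _ _ _ brs (under K) [set codom_map p | p in P]) => //.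
- by move=> _ [p _ <-]; apply: codom_map_keeps.
- split; first exact: codom_map_keeps.
    by move=> _ [p Pp <-]; apply/wleE/jP.
  move=> f kf fP; have [u eu] := codom_map_surj kf.
  rewrite -eu; apply/wleE/jmin => p Pp; apply/wleE; rewrite eu.
  by apply: fP; exists p.
- exact: codom_map_keeps.
- by move=> _ c [p Pp <-]; apply: (disjointE p q).1; apply: Pq.
Qed.

(** A generator [w] from [J] is described by [J], whereas [atomic_elementary] describes
    atoms by their targets; inverses of atoms being atoms, it applies to [w^-1]. *)
Lemma atomic_generator J K (w : mor J K) : atomic X w <-> bh_generator w.
Proof.
have JPi := @under_sub J.
have kw : keeps (under J) (bh_fun w).
  by rewrite -codom_map_minv; apply: codom_map_keeps.
transitivity (atomic X (minv w)).
  by split=> /(atomic_inv gset_preprincipal)//; rewrite minvK.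
rewrite atomic_elementary codom_map_minv; split=> -[a].
  move=> /(elementary_nuP brs JPi)[Pa nJa _ fin e]; exists a; split=> //.
  rewrite -(bh_image w) e => _ [x Jx <-].
  apply: (nu_simple brs JPi Pa fin Jx).
  by rewrite -e; apply: kw.2; exists x.
by move=> [[Pa nJa] fin e _]; exists a; apply/(elementary_nuP brs JPi).
Qed.

End BrinkHowlett.

Theorem theorem1p22 (R : realType) (V : lmodType R) (B : {symmetric V})
    (Phi Pi : set V) (brs : based_root_system B Phi Pi)
    (O : set (full_bh_groupoid brs)) (hO : union_of_components O) :
  [/\ preprincipal (root_gset O),
      rootoidal (root_gset O) &
      forall (J K : bh_groupoid O) (w : mor J K),
        atomic (root_gset O) w <-> bh_generator w] /\
  [/\ principal (real_compression (root_gset O)),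
      rootoidal (real_compression (root_gset O)) &
      forall (J K : bh_groupoid O) (w : mor J K),
        simple (real_compression (root_gset O)) w <-> bh_generator w].
Proof.
have pre := gset_preprincipal hO; have root := gset_rootoidal hO.
have [prin simp] := rec_principal pre.
have gen := atomic_generator hO.
split; split=> // [|J K w]; first exact: rec_rootoidal.
by rewrite simp; apply: gen.
Qed.
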